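(* Let $G=(V,E)$ be an Erdős–Rényi random graph on $n$ vertices in which every edge is present independently with probability $p=2\log n/n$. With high probability over the randomness of $G$, every distance labeling scheme for $G$ that recovers all pairwise distances exactly has total length at least $\Omega(n^{3/2}/\log^4 n)$. In particular, with high probability every 2-hop cover of $G$ stores at least $\Omega(n^{3/2}/\log^4 n)$ landmarks in total.
   Context: A distance labeling scheme assigns to each vertex $v$ a binary string $\mathcal L(v)$ such that a decoding rule fixed in advance (not depending on $G$) computes $\mathrm{dist}_G(x,y)$ from $\mathcal L(x)$ and $\mathcal L(y)$ alone, for all $x,y\in V$; its total length is $\sum_{v}|\mathcal L(v)|$. A 2-hop cover is a landmark labeling $\{L(v)\}$ (each landmark $z\in L(v)$ stored with $\mathrm{dist}(v,z)$) such that $\min_{z\in L(x)\cap L(y)}(\mathrm{dist}(x,z)+\mathrm{dist}(z,y))=\mathrm{dist}(x,y)$ for all pairs $x,y$ in the same connected component; its number of landmarks is $\sum_v|L(v)|$. ''With high probability'' means with probability tending to $1$ as $n\to\infty$. *)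

(* Defs.v *)
From HB Require Import structures.
From mathcomp Require Import all_boot all_order all_algebra.
From mathcomp Require Import all_classical all_reals all_analysis.
Set Implicit Arguments. Unset Strict Implicit. Unset Printing Implicit Defensive.
Import Order.TTheory GRing.Theory Num.Theory.
Local Open Scope ring_scope.

(* A simple graph on vertex set 'I_n is encoded by its edge set E : a set of
   ordered pairs (i,j) with i < j (each unordered edge stored once). *)
Definition upairs (n : nat) : {set 'I_n * 'I_n} :=
  [set ij : 'I_n * 'I_n | (ij.1 < ij.2)%N].

Definition adj n (E : {set 'I_n * 'I_n}) : rel 'I_n :=
  fun x y => ((x, y) \in E) || ((y, x) \in E).

Definition walkb n (E : {set 'I_n * 'I_n}) (x y : 'I_n) (k : nat) : bool :=
  [exists t : k.-tuple 'I_n, path (adj E) x t && (last x t == y)].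

(* graph distance; None = infinity (x and y in different components).
   A shortest walk has fewer than n edges, so the least k < n with a walk
   of length k is the distance. *)
Definition dist n (E : {set 'I_n * 'I_n}) (x y : 'I_n) : option nat :=
  let k := find (walkb E x y) (iota 0 n) in
  if (k < n)%N then Some k else None.

Definition dsum (a b : option nat) : option nat :=
  match a, b with Some a, Some b => Some (a + b)%N | _, _ => None end.

Definition ER_prob (R : realType) (n : nat) (p : R)
    (P : {set 'I_n * 'I_n} -> Prop) : R :=
  \sum_(E : {set 'I_n * 'I_n} | E \subset upairs n)
     p ^+ #|E| * (1 - p) ^+ (#|upairs n| - #|E|) * (`[< P E >])%:R.

Definition pn (R : realType) (n : nat) : R := 2 * ln (n%:R) / n%:R.

Definition bound_fn (R : realType) (n : nat) : R :=
  n%:R * Num.sqrt (n%:R) / (ln (n%:R)) ^+ 4.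

(* A decoder (fixed in advance, may depend on n but not on G) maps two binary
   labels to a distance (None = infinity). *)
Definition decoder := nat -> seq bool -> seq bool -> option nat.

Definition is_dist_labeling n (dec : decoder) (E : {set 'I_n * 'I_n})
    (lab : 'I_n -> seq bool) : Prop :=
  forall x y : 'I_n, dec n (lab x) (lab y) = dist E x y.

Definition total_length n (lab : 'I_n -> seq bool) : nat :=
  (\sum_(v : 'I_n) size (lab v))%N.

Definition is_2hop_cover n (E : {set 'I_n * 'I_n}) (L : 'I_n -> {set 'I_n})
    : Prop :=
  forall (x y : 'I_n) (d : nat), dist E x y = Some d ->
    (exists2 z, z \in L x :&: L y & dsum (dist E x z) (dist E z y) = Some d) /\
    (forall z, z \in L x :&: L y -> forall e,
        dsum (dist E x z) (dist E z y) = Some e -> (d <= e)%N).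

Definition num_landmarks n (L : 'I_n -> {set 'I_n}) : nat :=
  (\sum_(v : 'I_n) #|L v|)%N.

(* Main.v *)
Require Import Defs.
From HB Require Import structures.
From mathcomp Require Import all_boot all_order all_algebra.
From mathcomp Require Import all_classical all_reals all_analysis.
From mathcomp Require Import fintype finset ring lra zify.
Set Implicit Arguments. Unset Strict Implicit. Unset Printing Implicit Defensive.
Import numFieldNormedType.Exports.
Import Order.TTheory GRing.Theory Num.Theory.
Local Open Scope ring_scope.

(**
Write lam = 2 ln n for the mean degree, choose m with
lam^(2m+4) <= n < lam^(2m+6), and cut the vertices into blocks of about
n / lam^(m+1) vertices.  For a block S fix disjoint sets U (most vertices) and
W (a fraction about 1/lam) outside S, and count the simple paths
x, u_1, ..., u_m, w with x in S, u_i in U and w in W.  The second moment method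
shows that with high probability most x in S have about the expected number of
such paths; a second-moment count of pairs of paths with a common end shows
that the ends are spread out; a first-moment count shows that most pairs of S
are at distance more than 2m+3.

Now fix the set H of pairs of S that are at distance more than 2m+3.  If (x, y)
is in H, no end of a path from x is adjacent to an end of a path from y.  The
edges inside W are independent of the paths, and by Cauchy-Schwarz about
(n / lam)^2 of them are so excluded, hence a given H has probability at most
exp(- c n / lam).  Short labels (or few landmarks) on S leave too few
possibilities for H, and if the total is small then, for most blocks, the
labels on the block are short.
*)

(** A second scale [z], with [ln lam = z ^+ 2], governs the proportion of W. A vertex has about [z]
    neighbours in W, with [z] unbounded: in the second-moment bound the last step weighs |W|p + 2
    against |W|p in the mean, and this ratio must tend to 1. On the other hand W is lost to each of
    the m inner vertices, at the cost of a factor (1 - O(z / lam))^m. As m is at most lam / (4 ln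
    lam), the choice z = sqrt (ln lam) keeps this loss at O(1/z). The same [z] is the slack in
    Markov's inequality; it cancels in the number of excluded edges, because the number of paths
    also grows with [z].

    An error O(1/z) is too large for a union bound over blocks. Typical blocks are therefore found
    by averaging, and only the exponentially small probability of a fixed H is summed over blocks
    and codes.

    Of the four logarithms, two come from the block size, which can reach sqrt(n) lam^2, one from
    the exponent n / lam, and one from the O(log n) bits of a landmark. *)

(** * Random subsets with independent elements *)

Section RandomSubset.
Variables (R : realFieldType) (T : finType) (U : {set T}) (p : R).
Implicit Types (E X : {set T}) (f g : {set T} -> R).

Definition rsmean f : R :=
  \sum_(E : {set T} | E \subset U)
     p ^+ #|E| * (1 - p) ^+ (#|U| - #|E|) * f E.

(** Independence of the elements: expanding the product gives one term per choice function, and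
    those supported on [U] are the subsets of [U]. *)
Lemma rsmean_prod (phi : T -> bool -> R) :
  rsmean (fun E => \prod_(e in U) phi e (e \in E)) =
  \prod_(e in U) (p * phi e true + (1 - p) * phi e false).
Proof.
have -> : \prod_(e in U) (p * phi e true + (1 - p) * phi e false) =
  \prod_(e in U) \sum_(b : bool) ((if b then p else 1 - p) * phi e b).
  by apply: eq_bigr => e _; rewrite big_bool.
rewrite (big_distr_big false) /rsmean.
rewrite (reindex_onto (fun E : {set T} => [ffun e => e \in E])
                      (fun h : {ffun T -> bool} => [set e | h e])) /=; last first.
  by move=> h _; apply/ffunP => e; rewrite ffunE inE.
apply: eq_big => [E|E EU].
  have -> : [set e | [ffun e0 => e0 \in E] e] = E.
    by apply/setP => e; rewrite inE ffunE.
  rewrite eqxx andbT; apply/subsetP/pffun_onP => [EU|[EU _] e eE].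
    split=> [|//]; apply/supportP => e; rewrite ffunE.
    by apply: contraNF => /EU.
  by apply: (subsetP EU); rewrite inE ffunE eE.
under [RHS]eq_bigr => e eU do rewrite ffunE.
rewrite big_split /=; congr (_ * _).
rewrite (bigID (mem E)) /=; congr (_ * _).
  under eq_bigr => e /andP[_ ->] do over.
  rewrite prodr_const; congr (_ ^+ _); apply: eq_card => e.
  by rewrite [RHS]unfold_in /=; move: (subsetP EU e); case: (e \in E) => [->|] //; rewrite andbF.
under eq_bigr => e /andP[_ /negbTE->] do over.
rewrite prodr_const -cardsDS //; congr (_ ^+ _); apply: eq_card => e.
by rewrite [RHS]unfold_in inE /= andbC.
Qed.

Lemma rsmean_eq f g : (forall E, E \subset U -> f E = g E) ->
  rsmean f = rsmean g.
Proof. by move=> fg; apply: eq_bigr => E EU; rewrite fg. Qed.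

Lemma rsmean_subset X : X \subset U ->
  rsmean (fun E => (X \subset E)%:R) = p ^+ #|X|.
Proof.
move=> XU; pose phi e b : R := if e \in X then (b : bool)%:R else 1.
rewrite (rsmean_eq (g := fun E => \prod_(e in U) phi e (e \in E))); last first.
  move=> E EU; case: (boolP (X \subset E)) => [/subsetP XE|].
    by rewrite big1 //= => e _; rewrite /phi; case: ifP => // /XE ->.
  case/subsetPn=> e eX eE; rewrite (bigD1 e) /=; last exact: (subsetP XU).
  by rewrite {1}/phi eX (negbTE eE) mul0r.
rewrite rsmean_prod /phi (bigID (mem X)) /= [X in _ * X]big1 ?mulr1; last first.
  by move=> e /andP[_ /negbTE->]; ring.
under eq_bigr => e /andP[_ ->] do rewrite mulr1 mulr0 addr0.
rewrite prodr_const; congr (_ ^+ _); apply: eq_card => e.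
by rewrite unfold_in /= andbC; move: (subsetP XU e); case: (e \in X) => [->|].
Qed.

Lemma rsmean_const c : rsmean (fun=> c) = c.
Proof.
have h1 : rsmean (fun=> 1) = 1.
  rewrite -[RHS](expr0 p) -(cards0 T) -(rsmean_subset (sub0set U)).
  by apply: rsmean_eq => E _; rewrite sub0set.
rewrite -[RHS]mulr1 -[in RHS]h1 mulr_sumr.
by apply: eq_bigr => E _; rewrite mulr1 mulrC.
Qed.

Lemma rsmeanD f g : rsmean (fun E => f E + g E) = rsmean f + rsmean g.
Proof. by rewrite -big_split; apply: eq_bigr => E _; rewrite mulrDr. Qed.

Lemma rsmeanZ c f : rsmean (fun E => c * f E) = c * rsmean f.
Proof. by rewrite mulr_sumr; apply: eq_bigr => E _; rewrite mulrCA. Qed.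

Lemma rsmean_sum (I : Type) (r : seq I) (P : pred I) (F : I -> {set T} -> R) :
  rsmean (fun E => \sum_(i <- r | P i) F i E) = \sum_(i <- r | P i) rsmean (F i).
Proof.
by rewrite exchange_big; apply: eq_bigr => E _; rewrite mulr_sumr.
Qed.

Hypothesis p01 : 0 <= p <= 1.

Lemma rsmean_le f g : (forall E, E \subset U -> f E <= g E) ->
  rsmean f <= rsmean g.
Proof.
case/andP: p01 => p0 p1 fg; apply: ler_sum => E EU.
by rewrite ler_wpM2l ?fg // mulr_ge0 // exprn_ge0 // subr_ge0.
Qed.

Lemma rsmean_ge0 f : (forall E, E \subset U -> 0 <= f E) -> 0 <= rsmean f.
Proof. by move=> f0; rewrite -(rsmean_const 0); apply: rsmean_le. Qed.

(* Conditioning on the part of E inside U1 fixes the set S E, whose elements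
   are then still independent. *)
Lemma rsmean_avoid (U1 : {set T}) (S : {set T} -> {set T}) (m : nat) :
  (forall E, S E = S (E :&: U1)) -> (forall E, S E \subset U :\: U1) ->
  rsmean (fun E => ((m <= #|S E|)%N && [disjoint E & S E])%:R) <= (1 - p) ^+ m.
Proof.
move=> SE SU; case/andP: p01 => p0 p1.
have q01 : 0 <= 1 - p <= 1 by rewrite subr_ge0 p1 lerBlDr lerDl.
pose I A E : R := (E :&: U1 == A)%:R.
have sumI E : \sum_A I A E = 1.
  rewrite (bigD1 (E :&: U1)) //= /I eqxx big1 ?addr0 // => A.
  by rewrite eq_sym => /negbTE->.
have meanI A (X : {set T}) : X \subset U :\: U1 ->
  rsmean (fun E => I A E * [disjoint E & X]%:R) = rsmean (I A) * (1 - p) ^+ #|X|.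
  have [AU|nAU] := boolP (A \subset U :&: U1); last first.
    have I0 E : E \subset U -> I A E = 0.
      move=> EU; rewrite /I; case: eqP => // EA.
      by case/negP: nAU; rewrite -EA setSI.
    rewrite (rsmean_eq (g := fun=> 0)) => [|E EU]; last by rewrite I0 ?mul0r.
    by rewrite (rsmean_eq I0) !rsmean_const mul0r.
  (* The first factor does not involve [Y]; the case of the empty set identifies it with the mean of
     [I A]. *)
  have key (Y : {set T}) : Y \subset U :\: U1 ->
    rsmean (fun E => I A E * [disjoint E & Y]%:R) =
    (\prod_(e in U) (if e \in U1 then (if e \in A then p else 1 - p) else 1))
      * (1 - p) ^+ #|Y|.
    move=> YU; pose phi e b : R :=
      ((e \in U1) ==> (b == (e \in A)))%:R * ((e \in Y) ==> ~~ b)%:R.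
    rewrite (rsmean_eq (g := fun E => \prod_(e in U) phi e (e \in E))); last first.
      move=> E EU; rewrite /I -natrM mulnb; case: (boolP (_ && _)).
        case/andP=> /eqP EA dEY; rewrite big1 // => e eU; rewrite /phi.
        rewrite -EA inE; case: (boolP (e \in E)) => eE.
          rewrite (disjointFr dEY eE) /=; case: (e \in U1) => /=; ring.
        by rewrite /= implybT; case: (e \in U1) => /=; ring.
      move=> nh; have : [exists e in U, phi e (e \in E) == 0].
        move: nh; apply: contraNT => /exists_inPn phn0.
        have ph e : e \in U -> ((e \in U1) ==> ((e \in E) == (e \in A))) && ((e \in Y) ==> (e \notin E)).
          by move=> /phn0; rewrite /phi; do 2![case: (_ ==> _)]; rewrite ?mul0r ?mulr0 ?eqxx.
        apply/andP; split.
          apply/eqP/setP => e; rewrite inE.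
          have [eU|enU] := boolP (e \in U).
            case/andP: (ph _ eU); case: (boolP (e \in U1)) => /= [_ /eqP->|eU1 _ _]; rewrite ?andbT ?andbF //.
            by apply/esym/negbTE; apply: contra eU1 => /(subsetP AU); rewrite inE => /andP[].
          have -> : (e \in E) = false by apply/negbTE; apply: contra enU; apply/subsetP.
          by apply/esym/negbTE; apply: contra enU => /(subsetP AU); rewrite inE => /andP[].
        rewrite disjoint_sym; apply/pred0P => e /=; apply/negbTE/negP => /andP[eY eE].
        have /(subsetP YU) := eY; rewrite inE => /andP[_ /ph].
        by rewrite eY eE andbF.
      by case/exists_inP=> e eU /eqP e0; rewrite (bigD1 e) //= e0 mul0r.
    rewrite rsmean_prod.
    have -> : (1 - p) ^+ #|Y| = \prod_(e in U) (if e \in Y then 1 - p else 1).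
      rewrite -prodr_const -big_mkcondr; apply: eq_bigl => e /=.
      by case: (boolP (e \in Y)) => [/(subsetP YU)|]; rewrite ?andbF // inE => /andP[_ ->].
    rewrite -big_split; apply: eq_bigr => e eU; rewrite /phi /=.
    have [eY|eY] := boolP (e \in Y).
      have := subsetP YU _ eY; rewrite inE => /andP[/negbTE-> _] /=; ring.
    by case: (e \in U1); case: (e \in A) => /=; ring.
  move=> XU; rewrite key // [in RHS](rsmean_eq (g := fun E => I A E * [disjoint E & set0]%:R)).
    by rewrite key ?sub0set // cards0 expr0 mulr1.
  by move=> E _; rewrite -setI_eq0 setI0 eqxx mulr1.
have -> : rsmean (fun E => ((m <= #|S E|)%N && [disjoint E & S E])%:R) =
   rsmean (fun E => \sum_A (m <= #|S A|)%:R * (I A E * [disjoint E & S A]%:R)).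
  apply: rsmean_eq => E _; rewrite (bigD1 (E :&: U1)) //= big1 => [|A]; last first.
    by rewrite /I eq_sym => /negbTE->; rewrite mul0r mulr0.
  by rewrite -SE /I eqxx mul1r addr0 -natrM mulnb.
rewrite rsmean_sum.
have -> : (1 - p) ^+ m = \sum_A rsmean (I A) * (1 - p) ^+ m.
  rewrite -mulr_suml -rsmean_sum (rsmean_eq (g := fun=> 1)) => [|E _]; last exact: sumI.
  by rewrite rsmean_const mul1r.
apply: ler_sum => A _; rewrite rsmeanZ meanI //.
have I0 : 0 <= rsmean (I A) by apply: rsmean_ge0 => E _; rewrite ler0n.
have [mA|] := boolP (m <= _)%N; last first.
  by rewrite mul0r mulr_ge0 // exprn_ge0 //; case/andP: q01.
rewrite mul1r ler_wpM2l //; apply: ler_wiXn2l => //; by case/andP: q01.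
Qed.

End RandomSubset.
Arguments rsmean_eq {R T U p f g}.

(** * Edges of a path *)

Section Edges.
Variable n : nat.
Implicit Types (u v x y w : 'I_n) (s L : seq 'I_n).

Definition uedge u v : 'I_n * 'I_n := if (u < v)%N then (u, v) else (v, u).

Lemma uedgeC u v : uedge u v = uedge v u.
Proof. by rewrite /uedge; case: ltngtP => // /val_inj->. Qed.

Lemma uedge_inj u v u' v' : uedge u v = uedge u' v' ->
  (u = u' /\ v = v') \/ (u = v' /\ v = u').
Proof. by rewrite /uedge; do 2![case: ifP => _] => -[-> ->]; [left|right|right|left]. Qed.

Lemma uedge_injl u v v' : uedge u v = uedge u v' -> v = v'.
Proof. by case/uedge_inj => [[]|[-> ->]]. Qed.

Definition edges x s := pairmap uedge x s.

Lemma edges_rcons x s w : edges x (rcons s w) = rcons (edges x s) (uedge (last x s) w).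
Proof. by rewrite /edges -cats1 pairmap_cat cats1. Qed.

Lemma size_edges x s : size (edges x s) = size s.
Proof. exact: size_pairmap. Qed.

Lemma mem_edges x s u v : uedge u v \in edges x s ->
  (u \in x :: s) && (v \in x :: s).
Proof.
elim: s x => //= y s IHs x; rewrite inE => /orP[/eqP/uedge_inj[][-> ->]|/IHs].
- by rewrite !inE !eqxx orbT.
- by rewrite !inE !eqxx orbT.
by rewrite ![_ \in x :: _]inE => /andP[-> ->]; rewrite !orbT.
Qed.

Lemma edges_uniq x s : uniq (x :: s) -> uniq (edges x s).
Proof.
elim: s x => //= y s IHs x /andP[xys ys]; rewrite IHs // andbT.
by apply: contra xys => /mem_edges/andP[].
Qed.

Definition list_edges L := if L is x :: s then edges x s else [::].

Lemma list_edges_nbr (pre suf : seq 'I_n) v u :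
  uniq (pre ++ v :: suf) -> uedge v u \in list_edges (pre ++ v :: suf) ->
  (exists pre', pre = rcons pre' u) \/ (exists suf', suf = u :: suf').
Proof.
elim: pre => [|a pre IHpre] /=.
  case: suf => [|h t] //= /andP[vht _]; rewrite inE => /orP[/eqP/uedge_injl->|].
    by right; exists t.
  by move/mem_edges => /andP[vin _]; rewrite vin in vht.
case/andP=> aN uN; case: pre IHpre uN aN => [|b pre] IHpre uN aN /=.
  rewrite inE => /orP[/eqP|].
    rewrite [uedge a v]uedgeC => /uedge_injl->; by left; exists [::].
  by move/(IHpre uN) => [[[|? ?] //]|]; right.
rewrite inE => /orP[/eqP/uedge_inj[][va _]|/(IHpre uN)].
- by rewrite va mem_cat mem_head orbT in aN.
- by move: uN => /=; rewrite va mem_cat mem_head orbT.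
by case=> [[pre' ->]|]; [left; exists (a :: pre')|right].
Qed.

(** A path has maximal degree two. This is the 2 added to the mean degree in every bound [Lam]
    below. *)
Lemma list_edges_deg L v : uniq L ->
  (#|[set u | uedge v u \in list_edges L]| <= 2)%N.
Proof.
move=> uL; have [vL|vL] := boolP (v \in L); last first.
  rewrite (_ : [set _ | _] = set0) ?cards0 //; apply/setP => u; rewrite !inE.
  apply/negbTE; apply: contra vL; case: L {uL} => //= x s.
  by move/mem_edges/andP=> [].
case/splitPr: vL uL => pre suf uL.
apply: (@leq_trans #|[set last v pre; head v suf]|); last first.
  by rewrite cards2; case: eqP.
apply/subset_leq_card/subsetP => u; rewrite !inE => /(list_edges_nbr uL).
by case=> [[pre' ->]|[suf' ->]]; rewrite ?last_rcons /= eqxx ?orbT.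
Qed.

(** An explicit list, so that sums over it unfold one vertex at a time. *)
Fixpoint seqs m : seq (seq 'I_n) :=
  if m is m'.+1 then [seq u :: s | u <- enum 'I_n, s <- seqs m'] else [:: [::]].

Lemma mem_seqs m s : (s \in seqs m) = (size s == m).
Proof.
elim: m s => [|m IHm] [|u s] //=.
  by apply/allpairsP => -[[? ?] [_ _]].
apply/allpairsP/idP => [[[v t] /= [_ tm [_ ->]]]|sm].
  by rewrite eqSS -IHm.
by exists (u, s); rewrite mem_enum IHm.
Qed.

Lemma big_seqsS (R : zmodType) m (F : seq 'I_n -> R) :
  \sum_(s <- seqs m.+1) F s = \sum_u \sum_(s <- seqs m) F (u :: s).
Proof. by rewrite /= big_allpairs_dep big_enum. Qed.

End Edges.

(** * Weight of all walks, conditionally on one path *)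

Section WeightedPaths.
Variables (R : realFieldType) (n : nat) (p : R).
Hypothesis p01 : 0 <= p <= 1.
Let p0 : 0 <= p. Proof. by case/andP: p01. Qed.
Let p1 : p <= 1. Proof. by case/andP: p01. Qed.
Implicit Types (u v x y w : 'I_n) (s q : seq 'I_n) (e : 'I_n * 'I_n).

(* [pwt X l] is the conditional probability of a simple path with edge list [l],
   given a path with edge list [X]. *)
Definition ewt (X : seq ('I_n * 'I_n)) e : R := if e \in X then 1 else p.
Definition pwt (X l : seq ('I_n * 'I_n)) : R := \prod_(e <- l) ewt X e.

Lemma ewt_ge0 X e : 0 <= ewt X e.
Proof. by rewrite /ewt; case: ifP. Qed.

Lemma ewt_le1 X e : ewt X e <= 1.
Proof. by rewrite /ewt; case: ifP. Qed.

Lemma pwt_ge0 X l : 0 <= pwt X l.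
Proof. by apply: prodr_ge0 => e _; apply: ewt_ge0. Qed.

Lemma pwt_cons X e l : pwt X (e :: l) = ewt X e * pwt X l.
Proof. exact: big_cons. Qed.

Lemma pwt_rcons X e l : pwt X (rcons l e) = pwt X l * ewt X e.
Proof. exact: big_rcons. Qed.

Lemma sum_ewt (A : {set 'I_n}) L u : uniq L ->
  \sum_(v in A) ewt (list_edges L) (uedge u v) <= #|A|%:R * p + 2.
Proof.
move=> uL; apply: (@le_trans _ _ (\sum_(v in A) (p + (uedge u v \in list_edges L)%:R))).
  by apply: ler_sum => v _; rewrite /ewt; case: ifP; rewrite ?addr0 // lerDr.
rewrite big_split /= sumr_const mulr_natl lerD2l -natr_sum.
rewrite ler_nat; apply: leq_trans (list_edges_deg u uL).
rewrite -sum1_card big_mkcond /= [in leqRHS]big_mkcond /=; apply: leq_sum => v _.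
by rewrite inE; case: ifP => // _; case: ifP.
Qed.

Section Bounds.
Variables (L : seq 'I_n) (Lam : R).
Hypothesis uL : uniq L.
Hypothesis LamE : n%:R * p + 2 <= Lam.
Let X := list_edges L.

Let Lam0 : 0 <= Lam.
Proof. by apply: le_trans LamE; rewrite addr_ge0 ?mulr_ge0 ?ler0n. Qed.
Let Lam1 : 1 <= Lam.
Proof.
apply: le_trans LamE; rewrite (_ : 2 = 1 + 1) // addrA lerDr.
by rewrite addr_ge0 ?mulr_ge0 ?ler0n.
Qed.

Let sumX u : \sum_v ewt X (uedge u v) <= Lam.
Proof.
apply: le_trans LamE; have /= := sum_ewt [set: 'I_n] u uL.
by rewrite cardsT card_ord; under eq_bigl do rewrite inE.
Qed.

(** Each step forward multiplies the total weight by at most [Lam]. The function [g] keeps the last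
    step apart, where a sharper bound is available. *)
Lemma sum_pwt_start m u (g : 'I_n -> R) (G : R) : (forall v, 0 <= g v <= G) ->
  \sum_(s <- seqs n m) pwt X (edges u s) * g (last u s) <= Lam ^+ m * G.
Proof.
move=> gG; have G0 : 0 <= G by case/andP: (gG u) => /le_trans; apply.
elim: m u => [|m IHm] u.
  by rewrite /= big_seq1 /pwt big_nil !mul1r; case/andP: (gG u).
rewrite big_seqsS /=; apply: (@le_trans _ _ (\sum_v ewt X (uedge u v) * (Lam ^+ m * G))).
  apply: ler_sum => v _; under eq_bigr do rewrite pwt_cons -mulrA.
  by rewrite -mulr_sumr ler_wpM2l ?ewt_ge0.
by rewrite -mulr_suml exprS -mulrA ler_wpM2r // mulr_ge0 // exprn_ge0.
Qed.

(** Here the start is free and is summed away first, by the symmetry of [uedge]. With the weight of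
    a last edge as [g], this handles walks with a prescribed end. *)
Lemma sum_pwt_end m (g : 'I_n -> R) : (forall v, 0 <= g v) ->
  \sum_u \sum_(s <- seqs n m) pwt X (edges u s) * g (last u s)
    <= Lam ^+ m * \sum_u g u.
Proof.
move=> g0; elim: m => [|m IHm].
  by rewrite mul1r; apply: ler_sum => u _; rewrite big_seq1 /pwt big_nil mul1r.
under eq_bigr do rewrite big_seqsS /=.
rewrite exchange_big /= exprS -mulrA; apply: le_trans (ler_wpM2l Lam0 IHm).
rewrite mulr_sumr; apply: ler_sum => v _.
under eq_bigr do (under eq_bigr do rewrite pwt_cons -mulrA; rewrite -mulr_sumr uedgeC).
rewrite -mulr_suml ler_wpM2r // sumr_ge0 // => s _.
by rewrite mulr_ge0 ?pwt_ge0.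
Qed.

Lemma sum_pwt_to m w :
  \sum_u \sum_(s <- seqs n m) pwt X (edges u (rcons s w)) <= Lam ^+ m.+1.
Proof.
under eq_bigr do under eq_bigr do rewrite edges_rcons pwt_rcons.
apply: le_trans (sum_pwt_end m (g := fun u => ewt X (uedge u w)) _) _.
  by move=> v; apply: ewt_ge0.
rewrite exprSr ler_wpM2l ?exprn_ge0 //.
by under eq_bigr do rewrite uedgeC; apply: sumX.
Qed.

(** The first edge leaves a vertex off [L], so it costs a full [p]; the rest is summed backwards
    from [w]. *)
Lemma sum_pwt_away m y w : y \notin L ->
  \sum_(s <- seqs n m) pwt X (edges y (rcons s w)) <= p * Lam ^+ m.
Proof.
move=> yL; have wty v : ewt X (uedge y v) = p.
  rewrite /ewt; case: ifP => // /[dup] yX; case: (L) @X yL yX => //= x s' ys'.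
  by move/mem_edges/andP => [/(negP ys')].
case: m => [|m]; first by rewrite big_seq1 /= pwt_cons wty /pwt big_nil.
rewrite big_seqsS /=.
under eq_bigr do (under eq_bigr do rewrite pwt_cons wty; rewrite -mulr_sumr).
by rewrite -mulr_sumr ler_wpM2l // sum_pwt_to.
Qed.

(* A path that leaves the path L has to come back to its last vertex w: the edge
   of departure costs a factor p and the rest is summed backwards from w. *)
Lemma sum_pwt_along (pre : seq 'I_n) v q w : L = pre ++ v :: rcons q w ->
  \sum_(s <- seqs n (size q) | uniq (pre ++ v :: rcons s w))
     pwt X (edges v (rcons s w)) <= 1 + (size q).+1%:R * p * Lam ^+ (size q).
Proof.
elim: q pre v => [|h q IHq] pre v LE.
  rewrite -big_filter /=; apply: (@le_trans _ _ 1); last first.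
    by rewrite lerDl mulr_ge0 ?mulr_ge0 ?ler0n.
  case: ifP => _; rewrite ?big_nil // big_seq1 /pwt big_seq1; exact: ewt_le1.
rewrite [size _]/= big_mkcond big_seqsS /=.
(* [Y u] bounds the continuations that leave [L] at once through [u]; [Z] collects those that follow
   [L] to its next vertex [h]. *)
pose Y u := \sum_(s <- seqs n (size q)) pwt X (edges u (rcons s w)).
pose Z := \sum_(s <- seqs n (size q) | uniq (rcons pre v ++ h :: rcons s w))
     pwt X (edges h (rcons s w)).
apply: (@le_trans _ _ (\sum_u (p * Y u + (u == h)%:R * Z))).
  apply: ler_sum => u _; have [Xvu|nXvu] := boolP (uedge v u \in X); last first.
    apply: (@le_trans _ _ (p * Y u)).
      rewrite mulr_sumr; apply: ler_sum => s _; case: ifP => _.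
        by rewrite pwt_cons {1}/ewt (negbTE nXvu).
      by rewrite mulr_ge0 ?pwt_ge0.
    by rewrite lerDl mulr_ge0 ?ler0n // sumr_ge0 // => s _; apply: pwt_ge0.
  have [->|uh] := eqVneq u h.
    rewrite mul1r /Z -[leLHS]add0r lerD ?mulr_ge0 //.
      by rewrite sumr_ge0 // => s _; apply: pwt_ge0.
    rewrite [leRHS]big_mkcond /=; apply: ler_sum => s _; rewrite cat_rcons; case: ifP => // _.
    by rewrite pwt_cons ler_piMl ?pwt_ge0 ?ewt_le1.
  (* The only other edge of [L] at [v] goes back to a vertex of [pre], which [uniq] forbids. *)
  rewrite mul0r addr0 big1 ?mulr_ge0 ?sumr_ge0 // => s _; first exact: pwt_ge0.
  case: ifP => // us; exfalso.
  have [] := @list_edges_nbr _ pre (rcons (h :: q) w) v u.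
  - by rewrite -LE.
  - by rewrite -LE.
  - case=> pre' pE; move: us; rewrite pE cat_rcons cat_uniq => /and3P[_ _ /=].
    by rewrite !inE eqxx orbT.
  - by case=> suf' [hu _]; rewrite hu eqxx in uh.
have h0 : \sum_u (u == h)%:R = 1 :> R.
  by rewrite (bigD1 h) //= eqxx big1 ?addr0 // => u /negbTE->.
rewrite big_split /= -mulr_sumr -mulr_suml h0 mul1r.
have h1 : p * \sum_u Y u <= p * Lam ^+ (size q).+1 by rewrite ler_wpM2l ?sum_pwt_to.
have h2 : Z <= 1 + (size q).+1%:R * p * Lam ^+ size q.
  by apply: IHq; rewrite cat_rcons.
apply: le_trans (lerD h1 h2) _.
rewrite addrCA lerD2l -[(size q).+2]addn1 natrD mulrDl mulrDl mul1r addrC lerD2r.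
by rewrite ler_wpM2l ?mulr_ge0 ?ler0n // exprS ler_peMl // exprn_ge0.
Qed.

End Bounds.
End WeightedPaths.

(** * Counting simple paths *)

Section SimplePaths.
Variables (n : nat).
Implicit Types (U : {set 'I_n}) (s : seq 'I_n).

Definition simple_in U s := all (mem U) s && uniq s.
Definition spaths U m := [seq s <- seqs n m | simple_in U s].

Lemma size_spaths U m : ((#|U| - m) ^ m <= size (spaths U m))%N.
Proof.
rewrite /spaths size_filter -sum1_count.
elim: m U => [|m IHm] U; first by rewrite expn0 /= big_cons big_nil.
rewrite /= big_mkcond big_allpairs_dep big_enum /=.
apply: (@leq_trans (\sum_(u in U) (#|U :\ u| - m) ^ m)).
  rewrite (eq_bigr (fun=> ((#|U| - m.+1) ^ m)%N)) => [|u uU]; last first.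
    by rewrite (cardsD1 u U) uU add1n subSS.
  by rewrite sum_nat_const expnS leq_mul2r leq_subr orbT.
rewrite [leqLHS]big_mkcond /=; apply: leq_sum => u _; case: ifP => // uU.
apply: leq_trans (IHm _) _; rewrite big_mkcond /=.
apply: leq_sum => s _; case: ifP => //; rewrite /simple_in /= uU /= => /andP[sU us].
rewrite us andbT ifT //; apply/andP; split; last first.
  by apply/negP => /(allP sU); rewrite /= !inE eqxx.
by apply: sub_all sU => v /=; rewrite !inE => /andP[].
Qed.

Lemma spathsP U m s : s \in spaths U m -> [/\ size s = m, all (mem U) s & uniq s].
Proof. by rewrite mem_filter mem_seqs => /andP[/andP[? ?] /eqP]. Qed.

End SimplePaths.

(** * Moments of path counts *)

Section PathMoments.
Variables (R : realFieldType) (n : nat) (p : R).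
Hypothesis p01 : 0 <= p <= 1.
Let p0 : 0 <= p. Proof. by case/andP: p01. Qed.
Let p1 : p <= 1. Proof. by case/andP: p01. Qed.
Implicit Types (E : {set 'I_n * 'I_n}) (l : seq ('I_n * 'I_n)).

Local Notation mean := (rsmean (upairs n) p).

Lemma uedge_upairs (u v : 'I_n) : u != v -> uedge u v \in upairs n.
Proof.
by rewrite /uedge => uv; case: ltngtP => [||/val_inj/eqP]; rewrite ?inE ?(negbTE uv).
Qed.

Lemma edges_upairs x (s : seq 'I_n) : uniq (x :: s) -> {subset edges x s <= upairs n}.
Proof.
elim: s x => //= y s IHs x /andP[xys ys] e; rewrite inE => /orP[/eqP->|/IHs->//].
by apply: uedge_upairs; apply: contraNneq xys => ->; rewrite mem_head.
Qed.

(** Both lists are present exactly when the union of their edge sets is, and only the edges of [l']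
    outside [l] cost a further [p]. *)
Lemma mean_all2 l l' : uniq l -> uniq l' -> {subset l <= upairs n} ->
  {subset l' <= upairs n} ->
  mean (fun E => (all (mem E) l)%:R * (all (mem E) l')%:R) = p ^+ size l * pwt p l l'.
Proof.
move=> ul ul' lU lU'; pose X := [set e in l]; pose Y := [set e in l'].
have -> : pwt p l l' = p ^+ #|Y :\: X|.
  rewrite -prodr_const /pwt (eq_bigr (fun e => if e \notin l then p else 1)).
    rewrite -big_mkcond -big_filter big_uniq ?filter_uniq //=; apply: eq_bigl => e.
    by rewrite mem_filter !inE.
  by move=> e _; rewrite /ewt; case: ifP.
have -> : size l = #|X| by rewrite cardsE; apply/esym/card_uniqP.
have -> : p ^+ #|X| * p ^+ #|Y :\: X| = p ^+ #|X :|: Y|.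
  by rewrite -exprD -[in RHS](cardsID X) setUK setDUl setDv set0U.
have XU : X :|: Y \subset upairs n.
  by apply/subsetP => e; rewrite !inE => /orP[/lU|/lU']; rewrite inE.
rewrite -(rsmean_subset p XU); apply: rsmean_eq => E _.
rewrite -natrM mulnb subUset; congr ((_ && _)%:R).
  by apply/allP/subsetP => h e el; [apply: h; rewrite inE in el|apply: h; rewrite inE].
by apply/allP/subsetP => h e el; [apply: h; rewrite inE in el|apply: h; rewrite inE].
Qed.

Lemma mean_all l : uniq l -> {subset l <= upairs n} ->
  mean (fun E => (all (mem E) l)%:R) = p ^+ size l.
Proof.
move=> ul lU; have := @mean_all2 l [::] ul isT lU.
rewrite /pwt big_nil mulr1 => <- //; apply: rsmean_eq => E _.
by rewrite mulr1.
Qed.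

Section SecondMoment.
Variables (I : eqType) (r : seq I) (l : I -> seq ('I_n * 'I_n)) (d : nat).
Hypothesis l_uniq : forall i, i \in r -> uniq (l i).
Hypothesis l_sub : forall i, i \in r -> {subset l i <= upairs n}.
Hypothesis l_size : forall i, i \in r -> size (l i) = d.

Lemma mean_count :
  mean (fun E => \sum_(i <- r) (all (mem E) (l i))%:R) = (size r)%:R * p ^+ d.
Proof.
rewrite rsmean_sum big_seq (eq_bigr (fun=> p ^+ d)) => [|i ir]; last first.
  by rewrite mean_all ?l_size //; [apply: l_uniq|apply: l_sub].
by rewrite -big_seq big_const_seq count_predT iter_addr_0 mulr_natl.
Qed.

(** Expand the square and condition on the first member of each pair; [B] bounds the conditional
    count of the second uniformly. *)
Lemma mean_count_sqr (B : R) :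
  (forall i, i \in r -> \sum_(j <- r) pwt p (l i) (l j) <= B) ->
  mean (fun E => (\sum_(i <- r) (all (mem E) (l i))%:R) ^+ 2)
     <= (size r)%:R * p ^+ d * B.
Proof.
move=> hB.
rewrite (rsmean_eq (g := fun E => \sum_(i <- r) \sum_(j <- r)
   (all (mem E) (l i))%:R * (all (mem E) (l j))%:R)); last first.
  by move=> E _; rewrite expr2 big_distrlr.
rewrite rsmean_sum -mulrA mulr_natl -iter_addr_0 -(count_predT r) -big_const_seq.
rewrite big_seq [leRHS]big_seq; apply: ler_sum => i ir.
rewrite rsmean_sum big_seq (eq_bigr (fun j => p ^+ d * pwt p (l i) (l j))) => [|j jr].
  by rewrite -big_seq -mulr_sumr ler_wpM2l ?exprn_ge0 ?hB.
by rewrite mean_all2 ?l_size //; do ?[exact: l_uniq|exact: l_sub].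
Qed.

End SecondMoment.

Section Layers.
Variables (S U W : {set 'I_n}) (m : nat).
Hypotheses (SU : [disjoint S & U]) (SW : [disjoint S & W]) (UW : [disjoint U & W]).

Definition nwalks x w E : R :=
  \sum_(s <- spaths U m) (all (mem E) (edges x (rcons s w)))%:R.
Definition nfan x E : R := \sum_(w in W) nwalks x w E.
Definition fan_mean : R := (size (spaths U m))%:R * #|W|%:R * p ^+ m.+1.

Lemma nwalks_ge0 x w E : 0 <= nwalks x w E.
Proof. by apply: sumr_ge0 => s _; rewrite ler0n. Qed.

Lemma spaths_uniq x w s : x \in S -> w \in W -> s \in spaths U m ->
  uniq (x :: rcons s w).
Proof.
move=> xS wW /spathsP[_ /allP sU us]; rewrite /= mem_rcons inE rcons_uniq us andbT.
rewrite negb_or; apply/andP; split; first (apply/andP; split).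
- by apply: contraTneq xS => ->; rewrite (disjointFl SW wW).
- by apply/negP => /sU /=; rewrite (disjointFr SU xS).
- by apply/negP => /sU /=; rewrite (disjointFl UW wW).
Qed.

Let fan_index := [seq (w, s) | w <- enum W, s <- spaths U m].

Lemma nfanE x E :
  nfan x E = \sum_(i <- fan_index) (all (mem E) (edges x (rcons i.2 i.1)))%:R.
Proof. by rewrite big_allpairs_dep big_enum. Qed.

Let fan_indexP i : i \in fan_index -> i.1 \in W /\ i.2 \in spaths U m.
Proof. by case/allpairsP=> -[w s] /= [] wW sU ->; rewrite mem_enum in wW. Qed.

Let size_fan_index : size fan_index = (#|W| * size (spaths U m))%N.
Proof. by rewrite size_allpairs -cardE. Qed.

Lemma mean_nfan x : x \in S -> mean (nfan x) = fan_mean.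
Proof.
move=> xS; rewrite (rsmean_eq (fun E _ => nfanE x E)).
rewrite (@mean_count _ _ _ m.+1).
- by rewrite size_fan_index natrM /fan_mean [_ * #|W|%:R]mulrC.
- by move=> i /fan_indexP[wW sU]; apply: edges_uniq; apply: spaths_uniq.
- by move=> i /fan_indexP[wW sU]; apply: edges_upairs; apply: spaths_uniq.
- by move=> i /fan_indexP[wW /spathsP[sm _ _]]; rewrite size_edges size_rcons sm.
Qed.

Variable Lam : R.
Hypothesis LamE : n%:R * p + 2 <= Lam.

(** The last step is weighted by the degree into [W] instead of [Lam]. The factor [#|W|%:R * p + 2]
    is close to the [#|W|%:R * p] in [fan_mean] once the latter is large, so the ratio to the
    squared mean can approach 1. *)
Lemma mean_nfan_sqr x : x \in S ->
  mean (fun E => nfan x E ^+ 2) <= fan_mean * (Lam ^+ m * (#|W|%:R * p + 2)).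
Proof.
move=> xS; rewrite (rsmean_eq (g := fun E =>
  (\sum_(i <- fan_index) (all (mem E) (edges x (rcons i.2 i.1)))%:R) ^+ 2)); last first.
  by move=> E _; rewrite nfanE.
have -> : fan_mean = (size fan_index)%:R * p ^+ m.+1.
  by rewrite size_fan_index natrM /fan_mean [_ * #|W|%:R]mulrC.
apply: mean_count_sqr.
- by move=> i /fan_indexP[wW sU]; apply: edges_uniq; apply: spaths_uniq.
- by move=> i /fan_indexP[wW sU]; apply: edges_upairs; apply: spaths_uniq.
- by move=> i /fan_indexP[wW /spathsP[sm _ _]]; rewrite size_edges size_rcons sm.
move=> [w0 s0] /fan_indexP[/= w0W s0U]; rewrite big_allpairs_dep /= big_enum /=.
have uL := spaths_uniq xS w0W s0U; set L := x :: rcons s0 w0 in uL.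
rewrite -[edges x (rcons s0 w0)]/(list_edges L).
rewrite exchange_big /=.
apply: le_trans (sum_pwt_start p01 uL LamE m x
  (g := fun u => \sum_(w in W) ewt p (list_edges L) (uedge u w)) _); last first.
  by move=> v; rewrite sum_ewt // andbT sumr_ge0 // => w _; apply: ewt_ge0.
rewrite big_filter big_mkcond; apply: ler_sum => s _.
have -> : pwt p (list_edges L) (edges x s) *
   (\sum_(w in W) ewt p (list_edges L) (uedge (last x s) w)) =
   \sum_(w in W) pwt p (list_edges L) (edges x (rcons s w)).
  by rewrite mulr_sumr; apply: eq_bigr => w _; rewrite edges_rcons pwt_rcons.
by case: ifP => // _; apply: sumr_ge0 => w _; apply: pwt_ge0.
Qed.

Definition energy E : R := \sum_(w in W) (\sum_(x in S) nwalks x w E) ^+ 2.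

Let Lam0 : 0 <= Lam.
Proof. by apply: le_trans LamE; rewrite addr_ge0 ?mulr_ge0 ?ler0n. Qed.

(** Fix the first path, from [x] to [w]. A second path from [x] follows it or pays for a detour,
    which gives the 1 and the [m.+1]. A path from another vertex of [S] starts off the first one and
    pays [p] at once, which gives the [#|S|]. *)
Lemma mean_energy :
  mean energy <= #|S|%:R * fan_mean * (1 + (m.+1 + #|S|)%:R * p * Lam ^+ m).
Proof.
pose J := [seq (x, s) | x <- enum S, s <- spaths U m].
have JP i : i \in J -> i.1 \in S /\ i.2 \in spaths U m.
  by case/allpairsP=> -[x s] /= [] xS sU ->; rewrite mem_enum in xS.
rewrite /energy rsmean_sum.
have -> : #|S|%:R * fan_mean * (1 + (m.+1 + #|S|)%:R * p * Lam ^+ m) =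
  \sum_(w in W) (size J)%:R * p ^+ m.+1 * (1 + (m.+1 + #|S|)%:R * p * Lam ^+ m).
  rewrite sumr_const -mulr_natl size_allpairs -cardE natrM /fan_mean; ring.
apply: ler_sum => w wW.
rewrite (rsmean_eq (g := fun E =>
  (\sum_(i <- J) (all (mem E) (edges i.1 (rcons i.2 w)))%:R) ^+ 2)); last first.
  by move=> E _; rewrite /nwalks big_allpairs_dep big_enum.
apply: mean_count_sqr.
- by move=> i /JP[wS sU]; apply: edges_uniq; apply: spaths_uniq.
- by move=> i /JP[wS sU]; apply: edges_upairs; apply: spaths_uniq.
- by move=> i /JP[wS /spathsP[sm _ _]]; rewrite size_edges size_rcons sm.
move=> [x s0] /JP[/= xS s0U]; rewrite big_allpairs_dep /= big_enum /=.
have uL := spaths_uniq xS wW s0U; set L := x :: rcons s0 w in uL.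
rewrite -[edges x (rcons s0 w)]/(list_edges L).
have [s0m /allP s0a _] := spathsP s0U.
rewrite (bigD1 x) //= natrD !mulrDl addrA; apply: lerD.
  apply: (@le_trans _ _ (\sum_(s <- seqs n m | uniq (x :: rcons s w))
     pwt p (list_edges L) (edges x (rcons s w)))).
    rewrite big_filter big_mkcond [leRHS]big_mkcond /= big_seq [leRHS]big_seq.
    apply: ler_sum => s sm; case: ifP => sU.
      by have /= -> := spaths_uniq xS wW (_ : s \in spaths U m); rewrite // mem_filter sU.
    by case: ifP => // _; apply: pwt_ge0.
  have /= := @sum_pwt_along _ _ p p01 _ _ uL LamE [::] x s0 w erefl.
  by rewrite s0m.
apply: (@le_trans _ _ (\sum_(y in S | y != x) p * Lam ^+ m)).
  apply: ler_sum => y /andP[yS yx].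
  apply: (@le_trans _ _ (\sum_(s <- seqs n m) pwt p (list_edges L) (edges y (rcons s w)))).
    rewrite big_filter big_mkcond; apply: ler_sum => s _.
    by case: ifP => // _; apply: pwt_ge0.
  apply: (sum_pwt_away p01 uL LamE).
  rewrite /L inE (negbTE yx) mem_rcons inE /= negb_or; apply/andP; split.
    by apply: contraTneq yS => ->; rewrite (disjointFl SW wW).
  by apply/negP => /s0a /=; rewrite (disjointFr SU yS).
rewrite sumr_const -mulrA [leRHS]mulr_natl ler_wpMn2l ?mulr_ge0 ?exprn_ge0 //.
by apply/subset_leq_card/subsetP => y; rewrite unfold_in /= => /andP[].
Qed.

Lemma markov_energy (tau : R) : 0 < tau ->
  mean (fun E => (tau < energy E)%R%:R) <=
  #|S|%:R * fan_mean * (1 + (m.+1 + #|S|)%:R * p * Lam ^+ m) / tau.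
Proof.
move=> tau0; apply: (@le_trans _ _ (mean (fun E => tau^-1 * energy E))).
  apply: rsmean_le => // E _; case: ltP => [tE|_].
    by rewrite mulrC ler_pdivlMr // mul1r ltW.
  by rewrite mulr_ge0 ?invr_ge0 ?(ltW tau0) // sumr_ge0 // => w _; rewrite sqr_ge0.
rewrite rsmeanZ mulrC ler_wpM2r ?invr_ge0 ?(ltW tau0) //; exact: mean_energy.
Qed.

(** Chebyshev's inequality for the squared deviations summed over [S]: a deficient vertex
    contributes at least a quarter of the squared mean, and more than an eighth of [S] is deficient,
    whence 32. *)
Lemma chebyshev_nfan : 0 < fan_mean -> (0 < #|S|)%N ->
  mean (fun E => (#|S| < 8 * #|[set x in S | (nfan x E < fan_mean / 2)%R]|)%:R)
   <= 32 * (Lam ^+ m * (#|W|%:R * p + 2) / fan_mean - 1).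
Proof.
move=> b0 k0; set b := fan_mean; set B := Lam ^+ m * _.
have k0' : 0 < #|S|%:R :> R by rewrite ltr0n.
pose V x E := (nfan x E - b) ^+ 2.
have kb0 : 0 < #|S|%:R * b ^+ 2 by apply: mulr_gt0 => //; apply: exprn_gt0.
have c0 : 0 <= 32 / (#|S|%:R * b ^+ 2) :> R.
  by apply: divr_ge0 => //; apply: mulr_ge0; [apply: ltW|apply: sqr_ge0].
apply: (@le_trans _ _ (mean (fun E => (32 / (#|S|%:R * b ^+ 2)) * \sum_(x in S) V x E))).
  apply: rsmean_le => // E _; case: ltnP => [h|_]; last first.
    by apply: mulr_ge0 => //; apply: sumr_ge0 => x _; apply: sqr_ge0.
  rewrite -[leLHS]/1 mulrAC ler_pdivlMr // mul1r.
  set Q := [set x in S | _] in h.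
  have h1 : \sum_(x in S) V x E >= #|Q|%:R * (b ^+ 2 / 4).
    rewrite mulr_natl -sumr_const big_mkcond [leRHS]big_mkcond /=; apply: ler_sum => x _.
    rewrite /Q inE; case: ifP => [/andP[-> hx]|_]; last by case: ifP => // _; apply: sqr_ge0.
    rewrite /V; move: (nfan x E) hx => N hx; have {}hx : N < b / 2 by [].
    have b0' : 0 < b by []; move: (b) b0' hx => b' b0' hx; nra.
  apply: le_trans (ler_wpM2l _ h1); last by [].
  have : #|S|%:R <= 8 * #|Q|%:R :> R by rewrite -natrM ler_nat ltnW.
  have : 0 < b ^+ 2 by apply: exprn_gt0.
  move: (b ^+ 2) => b2 b20 hQ; nra.
rewrite rsmeanZ rsmean_sum.
apply: (@le_trans _ _ (32 / (#|S|%:R * b ^+ 2) * \sum_(x in S) (b * B - b ^+ 2))).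
  apply: ler_wpM2l => //; apply: ler_sum => x xS.
  rewrite (rsmean_eq (g := fun E => nfan x E ^+ 2 + (- 2 * b) * nfan x E + b ^+ 2)).
    rewrite !rsmeanD rsmeanZ rsmean_const mean_nfan //.
    by have := mean_nfan_sqr xS; rewrite -/B -/b; lra.
  by move=> E _; rewrite /V; ring.
rewrite sumr_const -mulr_natl le_eqVlt; apply/orP; left; apply/eqP; field.
by rewrite !gt_eqF.
Qed.

End Layers.
End PathMoments.

(** * Walks and bounded distance *)

Section Walks.
Variable n : nat.
Implicit Types (E : {set 'I_n * 'I_n}) (x y z : 'I_n) (s : seq 'I_n).

Lemma walkbP E x y k :
  reflect (exists s, [/\ size s = k, path (adj E) x s & last x s = y]) (walkb E x y k).
Proof.
apply: (iffP existsP) => [[t /andP[pt /eqP lt]]|[s [sk ps ls]]].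
  by exists (val t); split => //; apply: size_tuple.
have sk' : size s == k by apply/eqP.
by exists (Tuple sk'); rewrite ps ls eqxx.
Qed.

Lemma adjC E x y : adj E x y = adj E y x.
Proof. exact: orbC. Qed.

Lemma walkb_sym E x y k : walkb E x y k -> walkb E y x k.
Proof.
case/walkbP=> s [sk ps ls]; apply/walkbP; exists (rev (belast x s)); split.
- by rewrite size_rev size_belast.
- rewrite -ls rev_path; apply: sub_path ps => u v /=; by rewrite adjC.
- by case: s ls {sk ps} => //= a s _; rewrite rev_cons last_rcons.
Qed.

Lemma walkb_cat E x y z i j : walkb E x y i -> walkb E y z j -> walkb E x z (i + j).
Proof.
case/walkbP=> s [si ps ls] /walkbP[t [tj pt lt]]; apply/walkbP; exists (s ++ t).
by rewrite size_cat si tj cat_path ps ls last_cat ls.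
Qed.

Lemma edges_path E x s : all (mem E) (edges x s) -> path (adj E) x s.
Proof.
elim: s x => //= y s IHs x /andP[xy /IHs->]; rewrite andbT /adj.
by move: xy; rewrite /uedge; case: ifP => _ ->; rewrite ?orbT.
Qed.

Lemma path_edges E x s : E \subset upairs n -> path (adj E) x s ->
  all (mem E) (edges x s).
Proof.
move=> /subsetP EU; elim: s x => //= y s IHs x /andP[xy /IHs->]; rewrite andbT.
by case/orP: xy => h; have := EU _ h; rewrite inE /= /uedge => xy;
  rewrite ?xy // ifF //; apply/negbTE; rewrite -leqNgt ltnW.
Qed.

Definition close E d x y := [exists j : 'I_d.+1, walkb E x y j].

Lemma closeP E d x y : reflect (exists2 j, (j <= d)%N & walkb E x y j) (close E d x y).
Proof.
apply: (iffP existsP) => [[j wj]|[j jd wj]]; first by exists j => //; rewrite -ltnS.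
by exists (Ordinal (jd : (j < d.+1)%N)).
Qed.

Lemma dist_walkb E x y d : dist E x y = Some d -> walkb E x y d.
Proof.
rewrite /dist; case: ifP => // kn [<-].
have h : has (walkb E x y) (iota 0 n) by rewrite has_find size_iota.
by have := nth_find 0 h; rewrite nth_iota.
Qed.

(** The search in [dist] stops below [n], hence the condition on [d]. *)
Lemma close_dist E d x y : (d < n)%N ->
  close E d x y = (if dist E x y is Some e then (e <= d)%N else false).
Proof.
move=> dn; apply/closeP/idP => [[j jd wj]|].
  have kj : (find (walkb E x y) (iota 0 n) <= j)%N.
    rewrite leqNgt; apply/negP => jk.
    have := before_find 0 jk; rewrite nth_iota ?add0n ?wj //.
    exact: leq_ltn_trans dn.
  rewrite /dist ifT ?(leq_trans kj) //.
  exact: leq_ltn_trans (leq_trans kj jd) dn.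
by case: dist (@dist_walkb E x y) => // e /(_ _ erefl) we ed; exists e.
Qed.

Lemma close_simple E d x y : x != y -> close E d x y ->
  exists s, [/\ (size s < d)%N, uniq (x :: rcons s y) & path (adj E) x (rcons s y)].
Proof.
move=> xy /closeP[j jd /walkbP[s [sj ps ls]]].
case/shortenP: ps ls => s' ps' us' ss' ls.
case/lastP: s' ps' us' ss' ls => [|s' y'] ps' us' ss'; first by move=> /eqP; rewrite (negbTE xy).
rewrite last_rcons => yy'; exists s'; rewrite -yy'; split => //.
apply: leq_trans jd; rewrite -sj; move/andP: us' => [_ us'].
by rewrite -(size_rcons s' y'); apply: uniq_leq_size.
Qed.

End Walks.

Section CauchySchwarz.
Variables (R : realFieldType) (I : finType).

(** Expand the sum of the squares of [N * c i - s], with [N] the size of [Z] and [s] the sum of the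
    [c i]. *)
Lemma sqr_sum_le_card (Z : {set I}) (c : I -> R) :
  (\sum_(i in Z) c i) ^+ 2 <= #|Z|%:R * \sum_(i in Z) c i ^+ 2.
Proof.
set s := \sum_(i in Z) c i; set q := \sum_(i in Z) _.
have [/eqP|] := posnP #|Z|.
  by rewrite cards_eq0 => /eqP Z0; rewrite /s Z0 big_set0 expr0n cards0 mul0r.
rewrite -(ltr0n R); set N := _%:R => N0.
have : 0 <= \sum_(i in Z) (N * c i - s) ^+ 2 by apply: sumr_ge0 => i _; apply: sqr_ge0.
have -> : \sum_(i in Z) (N * c i - s) ^+ 2 = N * (N * q - s ^+ 2).
  transitivity (\sum_(i in Z) (N ^+ 2 * c i ^+ 2 - 2 * N * s * c i + s ^+ 2)).
    by apply: eq_bigr => i _; ring.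
  by rewrite big_split sumrB /= -!mulr_sumr sumr_const -/s -/q -mulr_natl -/N; ring.
by rewrite pmulr_rge0 // subr_ge0.
Qed.

End CauchySchwarz.

(** * Few pairs are close *)

Section CloseMean.
Variables (R : realFieldType) (n : nat) (p : R).
Hypothesis p01 : 0 <= p <= 1.
Let p0 : 0 <= p. Proof. by case/andP: p01. Qed.
Local Notation mean := (rsmean (upairs n) p).

Lemma size_seqs m : size (seqs n m) = (n ^ m)%N.
Proof. by elim: m => //= m IHm; rewrite size_allpairs size_enum_ord IHm expnS. Qed.

(** First moment over simple paths: a walk of length at most [d] between distinct vertices shortens
    to a path with [i < d] inner vertices. *)
Lemma mean_close d x y : x != y ->
  mean (fun E => (close E d x y)%:R) <= \sum_(i < d) n%:R ^+ i * p ^+ i.+1.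
Proof.
move=> xy; apply: (@le_trans _ _ (mean (fun E => \sum_(i < d)
  \sum_(s <- seqs n i | uniq (x :: rcons s y)) (all (mem E) (edges x (rcons s y)))%:R))).
  apply: rsmean_le => // E EU; case: (boolP (close _ _ _ _)); last first.
    by move=> _; apply: sumr_ge0 => i _; apply: sumr_ge0 => s _; rewrite ler0n.
  case/(close_simple xy) => s [sd us ps].
  rewrite (bigD1 (Ordinal sd)) //= -[leLHS]addr0 lerD //; last first.
    by apply: sumr_ge0 => i _; apply: sumr_ge0 => t _; rewrite ler0n.
  rewrite -big_filter (bigD1_seq s) /=.
  - by rewrite path_edges // lerDl sumr_ge0 // => t _; rewrite ler0n.
  - by rewrite mem_filter mem_seqs eqxx andbT; exact: us.
  rewrite filter_uniq //; elim: (size s) => //= k IHk.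
  by rewrite allpairs_uniq ?enum_uniq // => -[? ?] [? ?] _ _ [-> ->].
rewrite rsmean_sum; apply: ler_sum => i _; rewrite rsmean_sum.
rewrite big_seq_cond (eq_bigr (fun=> p ^+ i.+1)); last first.
  move=> s /andP[]; rewrite mem_seqs => /eqP si us.
  by rewrite mean_all ?size_edges ?size_rcons ?si //; [apply: edges_uniq|apply: edges_upairs].
rewrite -big_seq_cond big_const_seq iter_addr_0 -natrX mulr_natl.
by rewrite ler_wpMn2l ?exprn_ge0 // -size_seqs count_size.
Qed.

(** The pairs [(x, x)] are always close; they account for the term [4 / #|S|%:R]. *)
Lemma markov_close d (S : {set 'I_n}) (eps : R) : (0 < #|S|)%N ->
  \sum_(i < d) n%:R ^+ i * p ^+ i.+1 <= eps ->
  mean (fun E => (#|S| ^ 2 < 4 * #|[set xy in setX S S | close E d xy.1 xy.2]|)%:R)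
    <= 4 / #|S|%:R + 4 * eps.
Proof.
move=> k0 he; have k0' : 0 < #|S|%:R :> R by rewrite ltr0n.
have eps0 : 0 <= eps.
  by apply: le_trans he; apply: sumr_ge0 => i _; rewrite mulr_ge0 ?exprn_ge0 ?ler0n.
apply: (@le_trans _ _ (mean (fun E => (4 / #|S|%:R ^+ 2) *
   \sum_(x in S) \sum_(y in S) (close E d x y)%:R))).
  apply: rsmean_le => // E _.
  have -> : \sum_(x in S) \sum_(y in S) (close E d x y)%:R =
     #|[set xy in setX S S | close E d xy.1 xy.2]|%:R :> R.
    rewrite pair_big /= -sum1_card natr_sum big_mkcond [in RHS]big_mkcond /=.
    apply: eq_bigr => -[x y] _; rewrite !inE /=.
    by case: (_ && _) => //=; case: (close _ _ _ _).
  set Q := #|_|; case: ltnP => [h|_].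
    rewrite -[leLHS]/1 mulrAC ler_pdivlMr ?exprn_gt0 // mul1r -natrX -natrM ler_nat.
    exact: ltnW.
  by rewrite !mulr_ge0 ?ler0n // invr_ge0 sqr_ge0.
rewrite rsmeanZ rsmean_sum.
apply: (@le_trans _ _ (4 / #|S|%:R ^+ 2 * \sum_(x in S) (1 + #|S|%:R * eps))).
  apply: ler_wpM2l; first by rewrite divr_ge0 // sqr_ge0.
  apply: ler_sum => x xS; rewrite rsmean_sum (bigD1 x) //=; apply: lerD.
    rewrite -[leRHS](rsmean_const (upairs n) p 1); apply: rsmean_le => // E _.
    by case: close.
  apply: (@le_trans _ _ (\sum_(y in S | y != x) eps)).
    apply: ler_sum => y /andP[_ yx]; apply: le_trans he; apply: mean_close.
    by rewrite eq_sym.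
  rewrite sumr_const mulr_natl ler_wpMn2l //.
  by apply/subset_leq_card/subsetP => y; rewrite unfold_in /= => /andP[].
rewrite sumr_const -mulr_natl le_eqVlt; apply/orP; left; apply/eqP; field.
by rewrite gt_eqF.
Qed.

End CloseMean.

(** * Edges excluded by a pattern of distant pairs *)

Section Slots.
Variables (R : realFieldType) (n : nat) (p : R).
Hypothesis p01 : 0 <= p <= 1.
Local Notation mean := (rsmean (upairs n) p).
Variables (S U W : {set 'I_n}) (m : nat).
Hypotheses (SU : [disjoint S & U]) (SW : [disjoint S & W]) (UW : [disjoint U & W]).
Implicit Types (E H : {set 'I_n * 'I_n}).

Local Notation wcount := (@nwalks R n U m).
Local Notation fcount := (@nfan R n U W m).
Local Notation ecount := (@energy R n S U W m).
Local Notation b := (@fan_mean R n p U W m).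

(* Edges whose presence would bring a pair of H within distance 2m+3. *)
Definition bridges H E : {set 'I_n * 'I_n} :=
  [set ww in setX W W | [exists xy in H, 0 < wcount xy.1 ww.1 E * wcount xy.2 ww.2 E]].

(** [bridges] holds ordered pairs, while an edge is stored with its smaller end first; both orders
    exclude the same edge. *)
Definition slots H E : {set 'I_n * 'I_n} :=
  [set e in upairs n | (e \in bridges H E) || ((e.2, e.1) \in bridges H E)].

Lemma nwalks_gt0 x w E : 0 < wcount x w E -> walkb E x w m.+1.
Proof.
move=> h; have [|/hasPn nh] := boolP (has (fun s => all (mem E) (edges x (rcons s w))) (spaths U m)).
  case/hasP=> s /spathsP[sm _ _] /edges_path ps; apply/walkbP; exists (rcons s w).
  by rewrite size_rcons sm last_rcons.
by move: h; rewrite /nwalks big_seq big1 ?ltxx // => s /nh/negbTE->.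
Qed.

Lemma bridges_walkb H E ww : ww \in bridges H E ->
  exists xy, [/\ xy \in H, walkb E xy.1 ww.1 m.+1 & walkb E xy.2 ww.2 m.+1].
Proof.
rewrite inE => /andP[_ /exists_inP[xy xyH]].
have := nwalks_ge0 R U m xy.1 ww.1 E; rewrite le_eqVlt => /orP[/eqP<-|h1].
  by rewrite mul0r ltxx.
by rewrite pmulr_rgt0 // => h2; exists xy; split => //; apply: nwalks_gt0.
Qed.

(** Cauchy-Schwarz over pairs of ends: [c ww] counts the pairs of paths that lead from a pair of [H]
    to [ww], and vanishes off the bridges. It is at most the product of the numbers of paths from
    [S] to the two ends, so its squares sum to at most the squared energy. *)
Lemma sqr_fans_le_bridges H E : H \subset setX S S ->
  (\sum_(xy in H) fcount xy.1 E * fcount xy.2 E) ^+ 2 <= #|bridges H E|%:R * ecount E ^+ 2.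
Proof.
move=> HS; pose c (ww : 'I_n * 'I_n) := \sum_(xy in H) wcount xy.1 ww.1 E * wcount xy.2 ww.2 E.
have c0 ww : 0 <= c ww.
  by apply: sumr_ge0 => xy _; rewrite mulr_ge0 ?nwalks_ge0.
have cZ ww : ww \in setX W W -> ww \notin bridges H E -> c ww = 0.
  move=> wW; rewrite inE wW /= => /exists_inPn h; rewrite /c big1 // => xy xyH.
  by apply/eqP; rewrite eq_le leNgt h //= mulr_ge0 ?nwalks_ge0.
have sumZ (f : 'I_n * 'I_n -> R) : (forall ww, c ww = 0 -> f ww = 0) ->
    \sum_(ww in setX W W) f ww = \sum_(ww in bridges H E) f ww.
  move=> f0; rewrite (bigID (mem (bridges H E))) /= [X in _ + X]big1 ?addr0; last first.
    by move=> ww /andP[h1 h2]; rewrite f0 // cZ.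
  by apply: eq_bigl => ww; rewrite [ww \in bridges _ _]inE andbA andbb.
have -> : \sum_(xy in H) fcount xy.1 E * fcount xy.2 E = \sum_(ww in bridges H E) c ww.
  rewrite -sumZ // /c exchange_big /=; apply: eq_bigr => xy _.
  rewrite /nfan big_distrlr /= pair_big /=; apply: eq_bigl => ww.
  by rewrite !inE.
apply: le_trans (sqr_sum_le_card _ _) _; rewrite ler_wpM2l ?ler0n //.
rewrite -sumZ; last by move=> ww ->; rewrite expr0n.
rewrite expr2 /energy big_distrlr /= pair_big /=.
rewrite [leRHS](eq_bigl (mem (setX W W))); last by move=> ww; rewrite !inE.
apply: ler_sum => ww _; rewrite -exprMn !expr2.
have cA : c ww <= (\sum_(x in S) wcount x ww.1 E) * (\sum_(x in S) wcount x ww.2 E).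
  rewrite big_distrlr /= pair_big /= /c big_mkcond [leRHS]big_mkcond /=.
  apply: ler_sum => xy _; case: ifP => [/(subsetP HS)|_]; first by rewrite inE => ->.
  by case: ifP => // _; rewrite mulr_ge0 ?nwalks_ge0.
by apply: ler_pM.
Qed.

(* [tau] bounds the number of pairs of paths with a common end. *)
Definition typical d tau E :=
  [&& 4 * #|[set xy in setX S S | close E d xy.1 xy.2]| <= #|S| ^ 2,
      8 * #|[set x in S | (fcount x E < b / 2)%R]| <= #|S| & (ecount E <= tau)%R]%N.

Lemma typical_fans E H d tau : typical d tau E -> 0 <= b ->
  H = [set xy in setX S S | ~~ close E d xy.1 xy.2] ->
  #|S|%:R ^+ 2 * b ^+ 2 / 8 <= \sum_(xy in H) fcount xy.1 E * fcount xy.2 E.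
Proof.
move=> /and3P[h1 h2 _] b0 HE.
pose G := [set x in S | (b / 2 <= fcount x E)%R].
have gS : (#|G| + #|[set x in S | (fcount x E < b / 2)%R]| = #|S|)%N.
  rewrite -(cardsID [set x | (b / 2 <= fcount x E)%R] S); congr (_ + _)%N; apply: eq_card => x.
    by rewrite !inE.
  by rewrite !inE -ltNge andbC.
have hS : (#|H| + #|[set xy in setX S S | close E d xy.1 xy.2]| = #|S| ^ 2)%N.
  rewrite -mulnn -cardsX -(cardsID [set xy | ~~ close E d xy.1 xy.2] (setX S S)) HE.
  congr (_ + _)%N; apply: eq_card => x; rewrite !inE //.
  by rewrite negbK andbC.
(* At least 3/4 of the pairs lie in [H] and at least 49/64 in [setX G G], so the overlap is at least
   33/64. *)
have hG : (2 * #|H :&: setX G G| >= #|S| ^ 2)%N.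
  have := cardsUI H (setX G G); rewrite cardsX.
  have : (#|H :|: setX G G| <= #|S| ^ 2)%N.
    rewrite -mulnn -cardsX; apply/subset_leq_card/subsetP => xy.
    rewrite HE !inE => /orP[/andP[]//|/andP[/andP[-> _] /andP[-> _]]//].
  have g7 : (7 * #|S| <= 8 * #|G|)%N by lia.
  have := leq_mul g7 g7; rewrite mulnACA [(8 * _ * _)%N]mulnACA.
  move: h1 hS; rewrite -mulnn; clear.
  by move: (#|S| * #|S|)%N (#|G| * #|G|)%N => kk gg; lia.
have Nb0 x : 0 <= fcount x E by apply: sumr_ge0 => w _; apply: nwalks_ge0.
apply: (@le_trans _ _ (\sum_(xy in H :&: setX G G) (b / 2) * (b / 2))).
  rewrite sumr_const -mulr_natl.
  have : #|S|%:R ^+ 2 <= 2 * #|H :&: setX G G|%:R :> R by rewrite -natrX -natrM ler_nat.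
  have := sqr_ge0 b; rewrite expr2; nra.
rewrite big_mkcond [leRHS]big_mkcond /=; apply: ler_sum => xy _.
rewrite inE; case: (xy \in H) => //=; case: ifP => [|_]; last by rewrite mulr_ge0.
by rewrite !inE => /andP[/andP[_ hx] /andP[_ hy]]; apply: ler_pM => //; apply: divr_ge0.
Qed.

(** The radius is that of two paths of length m+1 joined by one edge. Two such paths with a common
    end would be shorter still, so no bridge is a loop and each slot accounts for at most two
    bridges. *)
Lemma slots_disjoint E H d : E \subset upairs n -> d = (2 * m + 3)%N ->
  H = [set xy in setX S S | ~~ close E d xy.1 xy.2] ->
  [disjoint E & slots H E] /\ (#|bridges H E| <= 2 * #|slots H E|)%N.
Proof.
move=> EU dE HE.
have HW xy w w' : xy \in H -> walkb E xy.1 w m.+1 -> walkb E xy.2 w' m.+1 -> ~~ adj E w w'.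
  rewrite {1}HE inE => /andP[_ nc] w1 w2; apply: contra nc => ww'; apply/closeP.
  exists d => //; rewrite dE.
  have -> : (2 * m + 3 = m.+1 + (1 + m.+1))%N by lia.
  apply: walkb_cat w1 _; apply: walkb_cat (walkb_sym w2).
  by apply/walkbP; exists [:: w']; rewrite /= ww'.
have HD xy w : xy \in H -> walkb E xy.1 w m.+1 -> walkb E xy.2 w m.+1 -> false.
  rewrite {1}HE inE => /andP[_ /negP nc] w1 w2; exfalso; apply: nc; apply/closeP.
  exists (m.+1 + m.+1)%N; first by rewrite dE; lia.
  by apply: walkb_cat w1 (walkb_sym w2).
split.
  rewrite disjoint_sym; apply/pred0P => -[w w'] /=; apply/negbTE/negP => /andP[].
  rewrite inE => /andP[_ /orP[]] /bridges_walkb[xy [xyH /= w1 w2]] wE.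
    by have := HW _ _ _ xyH w1 w2; rewrite /adj wE.
  by have := HW _ _ _ xyH w1 w2; rewrite /adj wE orbT.
pose sw (e : 'I_n * 'I_n) := (e.2, e.1).
have : bridges H E \subset slots H E :|: sw @: slots H E.
  apply/subsetP => -[w w'] wZ; rewrite inE; case: (ltngtP w w') => ww'.
  - by rewrite !inE /= ww' in wZ *; rewrite wZ.
  - apply/orP; right; apply/imsetP; exists (w', w) => //.
    by rewrite inE /= [in X in _ && X]orbC wZ inE /= ww'.
  - by case/bridges_walkb: (wZ) => xy [xyH /= w1 w2]; move: (HD _ _ xyH w1); rewrite (val_inj ww') => /(_ w2).
move/subset_leq_card/leq_trans; apply; apply: leq_trans (leq_card_setU _ _) _.
by rewrite mul2n -addnn leq_add2l leq_imset_card.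
Qed.

Let U1 := upairs n :\: setX W W.

(** Of two consecutive vertices of a path at most one lies in [W], so no path uses an edge inside
    [W]. This is the independence that [rsmean_avoid] requires. *)
Lemma slots_local H E : H \subset setX S S -> slots H E = slots H (E :&: U1).
Proof.
move=> HS; have nw x w : x \in S -> w \in W -> wcount x w E = wcount x w (E :&: U1).
  move=> xS wW; apply: eq_big_seq => s sU; congr ((nat_of_bool _)%:R).
  have us := spaths_uniq SU SW UW xS wW sU.
  have eU1 : {subset edges x (rcons s w) <= U1}.
    move=> e eP; rewrite inE (edges_upairs us) // andbT.
    have xW : x \notin W by rewrite (disjointFr SW xS).
    have sW : all (fun u => u \notin W) s.
      by case/spathsP: sU => _ sU _; apply: sub_all sU => u /= uU; rewrite (disjointFr UW uU).
    elim: s x xW sW eP {us sU xS} => [|u s IHs] x xW /=.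
      rewrite inE => _ /eqP->; rewrite /uedge; case: ifP => _; rewrite inE /= (negbTE xW) //.
      by rewrite andbF.
    case/andP=> uW sW; rewrite inE => /orP[/eqP->|/(IHs u uW sW)//].
    by rewrite /uedge; case: ifP => _; rewrite inE /= (negbTE xW) ?andbF.
  apply/idP/idP => /allP h; apply/allP => e eP /=.
    by rewrite inE eU1 // andbT; apply: h.
  by have := h e eP; rewrite /= inE => /andP[].
have bE ww : (ww \in bridges H E) = (ww \in bridges H (E :&: U1)).
  rewrite !inE; case: (boolP ((ww.1 \in W) && (ww.2 \in W))) => //= /andP[w1 w2]; apply: eq_existsb => xy.
  case: (boolP (xy \in H)) => //= /(subsetP HS); rewrite inE => /andP[x1 x2].
  by rewrite !nw.
by apply/setP => e; rewrite [LHS]inE [RHS]inE !bE.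
Qed.

(** The pattern [C] is chosen before the graph is drawn, so [H] is a fixed set. A typical graph with
    this pattern misses all of [slots H E], which then has at least [M] elements, and [rsmean_avoid]
    applies. *)
Lemma mean_typical_pattern (C : rel 'I_n) d tau (M : nat) : 0 <= b -> 0 < tau ->
  d = (2 * m + 3)%N ->
  (2 * M)%:R * tau ^+ 2 <= (#|S|%:R ^+ 2 * b ^+ 2 / 8) ^+ 2 ->
  mean (fun E => (typical d tau E &&
      [forall x in S, forall y in S, close E d x y == C x y])%:R) <= (1 - p) ^+ M.
Proof.
move=> b0 tau0 dE hM.
pose H := [set xy in setX S S | ~~ C xy.1 xy.2].
have HS : H \subset setX S S by apply/subsetP => xy; rewrite inE => /andP[].
apply: le_trans (@rsmean_avoid R _ (upairs n) p p01 U1 (slots H) M _ _).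
- apply: rsmean_le => // E EU; rewrite ler_nat.
  case: (boolP (_ && _)) => //= /andP[tE /forall_inP hC].
  have HE : H = [set xy in setX S S | ~~ close E d xy.1 xy.2].
    apply/setP => -[x y]; rewrite !inE /=; case: (boolP ((x \in S) && (y \in S))) => //= /andP[xS yS].
    by have /forall_inP/(_ y yS)/eqP-> := hC x xS.
  have [dis le2] := slots_disjoint EU dE HE; rewrite dis andbT lt0b.
  have h1 := typical_fans tE b0 HE.
  have h2 := sqr_fans_le_bridges E HS.
  case/and3P: tE => _ _ etau.
  have e0 : 0 <= ecount E by apply: sumr_ge0 => w _; apply: sqr_ge0.
  have h3 : (2 * M)%:R * tau ^+ 2 <= #|bridges H E|%:R * tau ^+ 2.
    apply: le_trans hM _; apply: le_trans (_ : #|bridges H E|%:R * ecount E ^+ 2 <= _).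
      apply: le_trans h2; rewrite ler_pXn2r // ?nnegrE //.
        by rewrite divr_ge0 // mulr_ge0 ?sqr_ge0.
      apply: sumr_ge0 => xy _; apply: mulr_ge0; apply: sumr_ge0 => w _; exact: nwalks_ge0.
    by rewrite ler_wpM2l ?ler0n // ler_pXn2r // nnegrE ltW.
  move: h3; rewrite ler_pM2r ?exprn_gt0 // ler_nat => h3.
  by have := leq_trans h3 le2; rewrite leq_mul2l.
- by move=> E; apply: slots_local.
- move=> E; apply/subsetP => -[w w'] eS; rewrite inE [_ \in U1]inE.
  move: eS; rewrite inE => /andP[-> h]; rewrite /= !andbT negbK.
  by case/orP: h; rewrite inE => /andP[]; rewrite !inE /= // andbC.
Qed.

End Slots.

(** * Typical graphs for one vertex set *)

Section OnePart.
Variables (R : realFieldType) (n : nat) (p : R).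
Hypothesis p01 : 0 <= p <= 1.
Local Notation mean := (rsmean (upairs n) p).

(* [z] is the slack in Markov's inequality for the energy. *)
Lemma typical_part (S : {set 'I_n}) (mW m M : nat) (Lam eps b z : R) :
  (0 < #|S|)%N -> (#|S| + mW <= n)%N -> n%:R * p + 2 <= Lam -> 0 < b -> 0 < z ->
  \sum_(i < 2 * m + 3) n%:R ^+ i * p ^+ i.+1 <= eps ->
  b <= (n - #|S| - mW - m)%:R ^+ m * mW%:R * p ^+ m.+1 ->
  (m.+1 + #|S|)%:R * p * Lam ^+ m <= 5 ->
  (2 * M)%:R * (48 * z) ^+ 2 <= (#|S|%:R * b) ^+ 2 ->
  exists typ : pred {set 'I_n * 'I_n},
   mean (fun E => (~~ typ E)%:R) <= 4 / #|S|%:R + 4 * eps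
       + 32 * (Lam ^+ m * (mW%:R * p + 2) / b - 1) + z^-1 /\
   forall C : rel 'I_n, mean (fun E => (typ E &&
      [forall x in S, forall y in S, close E (2 * m + 3) x y == C x y])%:R)
     <= (1 - p) ^+ M.
Proof.
move=> k0 kn LamE b0 z0 heps hb h5 hM.
have [p0 p1] := andP p01.
have [W WS WE] : exists2 W : {set 'I_n}, W \subset ~: S & #|W| = mW.
  have : (mW <= #|~: S|)%N by rewrite cardsCs setCK card_ord; move: kn; clear; lia.
  case/card_geqP=> s [us sW sS]; exists [set x in s]; last first.
    by rewrite cardsE (card_uniqP us).
  by apply/subsetP => x; rewrite inE => /sS.
pose U := ~: (S :|: W).
have SW : [disjoint S & W] by rewrite disjoint_sym disjoints_subset.
have SU : [disjoint S & U] by rewrite disjoints_subset setCK subsetUl.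
have UW : [disjoint U & W] by rewrite disjoint_sym disjoints_subset setCK subsetUr.
have UE : #|U| = (n - #|S| - mW)%N.
  have := cardsC (S :|: W); rewrite -/U card_ord cardsU.
  by move: SW; rewrite -setI_eq0 => /eqP->; rewrite cards0 WE; clear; lia.
set bW := @fan_mean R n p U W m.
have bbW : b <= bW.
  apply: le_trans hb _; rewrite /bW /fan_mean WE ler_wpM2r ?exprn_ge0 //.
  by rewrite ler_wpM2r ?ler0n // -natrX ler_nat -UE size_spaths.
have bW0 : 0 < bW by apply: lt_le_trans bbW.
have k0' : 0 < #|S|%:R :> R by rewrite ltr0n.
(* The mean energy is at most 1 + 5 times [#|S|%:R * bW], so Markov's inequality fails with
   probability at most 1/z. The 48 in the hypothesis on [M] is this 6 times the 8 of
   [typical_fans]. *)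
pose tau := 6 * z * (#|S|%:R * bW).
have tau0 : 0 < tau by apply: mulr_gt0; apply: mulr_gt0.
exists (@typical R n p S U W m (2 * m + 3) tau); split; last first.
  move=> C; apply: (@mean_typical_pattern R n p p01 S U W m SU SW UW C _ tau M) => //.
    exact: ltW.
  have kb : (#|S|%:R * b) ^+ 2 <= (#|S|%:R * bW) ^+ 2.
    have kb0 : 0 <= #|S|%:R * b := mulr_ge0 (ltW k0') (ltW b0).
    have kb1 : #|S|%:R * b <= #|S|%:R * bW by apply: ler_wpM2l => //; apply: ltW.
    by rewrite ler_pXn2r ?nnegrE //; apply: le_trans kb0 kb1.
  rewrite -/bW -exprMn /tau; move: (#|S|%:R * bW) kb => Kb kb.
  have -> : (Kb ^+ 2 / 8) ^+ 2 = Kb ^+ 2 / 64 * Kb ^+ 2 by field.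
  rewrite exprMn mulrA ler_wpM2r ?sqr_ge0 //.
  by have := le_trans hM kb; rewrite !exprMn; lra.
apply: (@le_trans _ _ (mean (fun E =>
  (#|S| ^ 2 < 4 * #|[set xy in setX S S | close E (2 * m + 3) xy.1 xy.2]|)%N%:R
  + (#|S| < 8 * #|[set x in S | (nfan R U W m x E < bW / 2)%R]|)%N%:R
  + (tau < energy R S U W m E)%R%:R))).
  apply: rsmean_le => // E _; rewrite /typical !negb_and -!ltnNge -ltNge.
  by rewrite -!natrD ler_nat; do 2![case: (_ < _)%N]; case: (_ < _).
rewrite !rsmeanD; apply: lerD; first apply: lerD.
- exact: markov_close.
- apply: le_trans (chebyshev_nfan p01 SU SW UW LamE _ _) _ => //.
  rewrite WE -/bW ler_wpM2l // lerB // ler_wpM2l //.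
    rewrite mulr_ge0 ?exprn_ge0 ?addr_ge0 ?mulr_ge0 ?ler0n //.
    by apply: le_trans LamE; rewrite addr_ge0 ?mulr_ge0 ?ler0n.
  by rewrite lef_pV2 ?posrE.
- apply: le_trans (markov_energy p01 m SU SW UW LamE tau0) _.
  rewrite -/bW /tau; move: (_ * p * _) h5 => w h5; have Kb0 : 0 < #|S|%:R * bW := mulr_gt0 k0' bW0.
  move: (#|S|%:R * bW) Kb0 => Kb Kb0; rewrite ler_pdivrMr ?mulr_gt0 //.
  have -> : z^-1 * (6 * z * Kb) = Kb * 6 by field; rewrite gt_eqF.
  by rewrite ler_pM2l //; lra.
Qed.

End OnePart.

(** * Averaging over blocks and union bound over codes *)

Section Blocks.
Variables (R : realFieldType) (n : nat) (p : R).
Hypothesis p01 : 0 <= p <= 1.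
Local Notation mean := (rsmean (upairs n) p).
Variables (k q : nat).
Hypotheses (k0 : (0 < k)%N) (q0 : (0 < q)%N) (qkn : (q * k <= n)%N).

Definition block (j : 'I_q) : {set 'I_n} := [set i : 'I_n | (i %/ k == j)%N].

Lemma card_block j : #|block j| = k.
Proof.
have h (i : 'I_k) : (j * k + i < n)%N.
  apply: leq_trans qkn; apply: (@leq_trans (j * k + k)).
    by rewrite ltn_add2l.
  by rewrite -mulSnr leq_mul2r ltn_ord orbT.
rewrite -[RHS]card_ord -(card_imset _ (_ : injective (fun i => Ordinal (h i)))); last first.
  by move=> i i' /(congr1 val) /= /addnI /val_inj.
apply: eq_card => v; rewrite !inE; apply/eqP/imsetP => [vj|[i _ ->]] /=.
  have vk : (v %% k < k)%N by rewrite ltn_mod.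
  by exists (Ordinal vk) => //; apply: val_inj; rewrite /= -vj -divn_eq.
by rewrite divnMDl // divn_small ?addn0.
Qed.

Lemma sum_blocks (f : 'I_n -> nat) :
  (\sum_(j < q) \sum_(v in block j) f v <= \sum_v f v)%N.
Proof.
rewrite (exchange_big_dep predT) //=; apply: leq_sum => v _.
case: (pickP (fun j => v \in block j)) => [j0 vj0|vn]; last by rewrite big_pred0.
rewrite (big_pred1 j0) // => j /=; apply/idP/eqP => [|->//].
by move: vj0; rewrite !inE => /eqP vj0 /eqP vj; apply: val_inj; rewrite /= -vj vj0.
Qed.

(** By Markov's inequality fewer than half of the blocks are atypical, except with probability
    [2 * delta]. Fewer than half of them cost at least [mu.+1]. So some block is both typical and
    cheap, and its pattern is one of the codes. The cost is left abstract to cover label lengths and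
    numbers of landmarks alike. *)
Lemma mean_union (P : {set 'I_n * 'I_n} -> Prop) (K : finType)
    (C : 'I_q -> K -> rel 'I_n) (mu d M : nat) (delta : R) :
  (forall j, exists typ : pred {set 'I_n * 'I_n},
     mean (fun E => (~~ typ E)%:R) <= delta /\
     forall C : rel 'I_n, mean (fun E => (typ E && [forall x in block j,
        forall y in block j, close E d x y == C x y])%:R) <= (1 - p) ^+ M) ->
  (forall E : {set 'I_n * 'I_n}, E \subset upairs n -> P E -> exists2 cost : 'I_n -> nat,
      (2 * \sum_v cost v < q * mu.+1)%N &
      forall j, (\sum_(v in block j) cost v <= mu)%N ->
        exists c, {in block j &, forall x y, close E d x y = C j c x y}) ->
  mean (fun E => `[< P E >]%:R) <= 2 * delta + q%:R * (#|K|%:R * (1 - p) ^+ M).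
Proof.
move=> typ_ex HP.
have [typ typP] := choice typ_ex.
pose Pt E j c := typ j E && [forall x in block j, forall y in block j, close E d x y == C j c x y].
apply: (@le_trans _ _ (mean (fun E => (2 / q%:R) * \sum_j (~~ typ j E)%:R +
   \sum_j \sum_c (Pt E j c)%:R))).
  apply: rsmean_le => // E EU; case: asboolP => [PE|_]; last first.
    rewrite addr_ge0 ?mulr_ge0 ?invr_ge0 ?ler0n ?sumr_ge0 // => j _.
    by rewrite sumr_ge0 // => c _; rewrite ler0n.
  have [cost hc hcode] := HP E EU PE.
  have [bad|nbad] := leqP q (2 * \sum_j (~~ typ j E)).
    rewrite -[leLHS]addr0 lerD ?sumr_ge0 //; last first.
      by move=> j _; rewrite sumr_ge0 // => c _; rewrite ler0n.
    by rewrite -natr_sum mulrAC ler_pdivlMr ?ltr0n // mul1r -natrM ler_nat.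
  have [j /andP[tj cj]] : exists j, typ j E && (\sum_(v in block j) cost v <= mu)%N.
    apply/existsP; rewrite -[X in is_true X]negbK; apply/negP => /existsPn hn.
    have h1 : (q <= \sum_j (~~ typ j E) + \sum_j (mu < \sum_(v in block j) cost v)%N)%N.
      rewrite -big_split /= -[leqLHS](card_ord q) -sum1_card; apply: leq_sum => j _.
      by have := hn j; rewrite negb_and -ltnNge; case: (typ j E); case: (mu < _)%N.
    have h2 : ((\sum_j (mu < \sum_(v in block j) cost v)%N) * mu.+1 <= \sum_v cost v)%N.
      apply: leq_trans (sum_blocks cost); rewrite big_distrl /=; apply: leq_sum => j _.
      by case: ltnP; rewrite ?mul0n ?mul1n.
    by nia.
  have [c hC] := hcode j cj.
  rewrite -[leLHS]add0r lerD ?mulr_ge0 ?invr_ge0 ?ler0n ?sumr_ge0 //.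
  rewrite (bigD1 j) //= (bigD1 c) //=.
  have -> : Pt E j c.
    rewrite /Pt tj /=; apply/forall_inP => x xS; apply/forall_inP => y yS.
    by rewrite hC.
  rewrite -addrA lerDl; apply: addr_ge0; apply: sumr_ge0 => i _; first exact: ler0n.
  by apply: sumr_ge0 => c' _; apply: ler0n.
rewrite rsmeanD rsmeanZ !rsmean_sum; apply: lerD.
  apply: (@le_trans _ _ (2 / q%:R * \sum_(j < q) delta)).
    apply: ler_wpM2l; first by rewrite divr_ge0 ?ler0n.
    by apply: ler_sum => j _; case: (typP j).
  rewrite sumr_const card_ord -[delta *+ _]mulr_natl mulrA divfK //.
  by rewrite pnatr_eq0 -lt0n.
apply: (@le_trans _ _ (\sum_(j < q) \sum_(c : K) (1 - p) ^+ M)).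
  apply: ler_sum => j _; rewrite rsmean_sum; apply: ler_sum => c _.
  by case: (typP j) => _; apply.
by rewrite !sumr_const card_ord -[_ *+ q]mulr_natl -[_ *+ #|_|]mulr_natl.
Qed.

End Blocks.

(** * Elementary inequalities *)

Section Elementary.
Variable R : realFieldType.

Lemma geometric_le (x y : R) (d : nat) : 0 <= y -> 2 <= x * y ->
  \sum_(i < d.+1) x ^+ i * y ^+ i.+1 <= 2 * y * (x * y) ^+ d.
Proof.
move=> y0 xy; elim: d => [|d IHd]; first by rewrite big_ord1 !expr0; lra.
rewrite big_ord_recr /=; apply: le_trans (lerD IHd (lexx _)) _.
have -> : x ^+ d.+1 * y ^+ d.+2 = y * (x * y) ^+ d.+1 by rewrite exprMn [y ^+ d.+2]exprS; ring.
rewrite exprS; move: xy; set t := x * y => t2.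
have : 0 <= (t - 2) * (y * t ^+ d) by rewrite !mulr_ge0 ?exprn_ge0 //; lra.
lra.
Qed.

Lemma bernoulli_sub (x : R) (m : nat) : 0 <= x <= 1 -> 1 - m%:R * x <= (1 - x) ^+ m.
Proof.
move=> x01; elim: m => [|m IHm]; first by rewrite mul0r subr0.
rewrite exprSr; have h : 0 <= 1 - x by lra.
apply: le_trans (ler_wpM2r h IHm).
have : 0 <= m%:R * x ^+ 2 by rewrite mulr_ge0 ?ler0n ?sqr_ge0.
by rewrite -(natr1 m) expr2; lra.
Qed.

Lemma exists_log (B x : R) : 2 <= B -> 1 <= x -> (exists J, x < B ^+ J) ->
  exists j, B ^+ j <= x < B ^+ j.+1.
Proof.
move=> B2 x1 exJ; have [J xJ Jmin] := ex_minnP exJ.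
case: J xJ Jmin => [|j] xJ Jmin; first by rewrite expr0 ltNge x1 in xJ.
exists j; rewrite xJ andbT leNgt; apply/negP => /Jmin; lia.
Qed.

End Elementary.

(** * Choice of the parameters *)

Section Asymptotics.
Variables (R : realType) (n : nat) (lam z : R).
Local Notation N := (n%:R : R).
Local Notation p := (pn R n).
Hypotheses (lamE : lam = 2 * ln N) (ln_lam : ln lam = z ^+ 2) (z256 : 256 <= z).

Lemma lam_gt0 : 0 < lam.
Proof.
rewrite ltNge; apply/negP => /ln0 h; move: ln_lam; rewrite h => h'.
have z2 := z256; have : 0 < z ^+ 2 by rewrite exprn_gt0 //; lra.
by rewrite -h' ltxx.
Qed.

Lemma lam_ge : z ^+ 2 + 1 <= lam.
Proof.
by rewrite -ln_lam -[leRHS](lnK (_ : lam \is Num.pos)) ?posrE ?lam_gt0 // addrC expR_ge1Dx.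
Qed.

Lemma lam_big : 256 * 256 + 1 <= lam /\ 256 * z <= lam.
Proof. by have := lam_ge; have := z256; split; nra. Qed.

Lemma natr_gt0 : 0 < N.
Proof.
rewrite ltNge; apply/negP => /ln0 h; have := lam_gt0; rewrite lamE h; lra.
Qed.

Lemma natr_expR : N = expR (lam / 2).
Proof. by rewrite lamE mulrAC mulfV // mul1r lnK // posrE natr_gt0. Qed.

Lemma natr_ge_lam8 : 2 ^+ 48 * lam ^+ 8 <= N.
Proof.
have [l0 _] := lam_big.
have e1 : lam / 32 <= expR (lam / 32) by apply: le_trans (expR_ge1Dx _); lra.
have -> : N = expR (lam / 32) ^+ 16.
  by rewrite -expRM_natl natr_expR; congr expR; field.
apply: (@le_trans _ _ ((lam / 32) ^+ 16)); last by rewrite lerXn2r ?nnegrE ?expR_ge0 //; lra.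
(* Half of the sixteen powers absorb the constants: [lam / 1024] is at least 64. *)
have -> : (lam / 32) ^+ 16 = (lam / 1024) ^+ 8 * lam ^+ 8 by field.
rewrite ler_wpM2r ?exprn_ge0 //; first lra.
have -> : 2 ^+ 48 = 64 ^+ 8 :> R by ring.
have l64 : 64 <= lam / 1024 by lra.
by apply: lerXn2r l64; rewrite nnegrE; lra.
Qed.

Lemma natr_ge_lam (i : nat) : (i <= 8)%N -> 2 ^+ 48 * lam ^+ i <= N.
Proof.
move=> i8; apply: le_trans natr_ge_lam8; rewrite ler_wpM2l ?exprn_ge0 //.
by apply: ler_weXn2l => //; case: lam_big; lra.
Qed.

Lemma pn_lam : p = lam / N. Proof. by rewrite lamE. Qed.

Lemma mean_degree : N * p = lam.
Proof. by rewrite pn_lam mulrC divfK // gt_eqF ?natr_gt0. Qed.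

Lemma pn_bounds : 0 <= p <= 1.
Proof.
have [l0 _] := lam_big; have N0 := natr_gt0; have := natr_ge_lam (isT : (1 <= 8)%N).
by rewrite pn_lam divr_ge0 ?ler_pdivrMr //=; lra.
Qed.

(** The exponent moves by two because one more inner vertex lengthens both halves of a connection.
    The lower bound makes close pairs rare, the upper one limits the block size. *)
Lemma exists_depth : exists m : nat, lam ^+ (2 * m + 4) <= N < lam ^+ (2 * m + 6).
Proof.
have [l0 _] := lam_big.
have [|||j] := @exists_log R (lam ^+ 2) N.
- by rewrite expr2; nra.
- by have := natr_ge_lam (isT : (0 <= 8)%N); rewrite expr0; lra.
- exists n; apply: (@lt_le_trans _ _ (2 ^+ n)).
    by rewrite -natrX ltr_nat ltn_expl.
  by rewrite lerXn2r ?nnegrE ?exprn_ge0 //; nra.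
rewrite -!exprM => /andP[h1 h2].
have j2 : (2 <= j)%N.
  rewrite leqNgt; apply/negP => j2; suff : lam ^+ (2 * j.+1) <= N by rewrite leNgt h2.
  have := natr_ge_lam (isT : (4 <= 8)%N) => h4.
  apply: (@le_trans _ _ (lam ^+ 4)).
    by apply: ler_weXn2l; [lra|lia].
  have l4 : 0 <= lam ^+ 4 by rewrite exprn_ge0 //; lra.
  by apply: le_trans h4; rewrite ler_peMl // exprn_ege1 // ler1n.
exists (j - 2)%N; rewrite (_ : (2 * (j - 2) + 4 = 2 * j)%N); last lia.
by rewrite (_ : (2 * (j - 2) + 6 = 2 * j.+1)%N) ?h1 ?h2 //; lia.
Qed.

(* [m] is the number of inner vertices of a path, [k] and [q] the size and number
   of the blocks, [mW] the size of the last layer W, [M] the number of excluded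
   edges and [mu] the label length available to a block. *)
Section Depth.
Variable m : nat.
Hypothesis hm : lam ^+ (2 * m + 4) <= N < lam ^+ (2 * m + 6).
Let x := lam ^+ m.

Lemma depth_pow_ge1 : 1 <= x.
Proof. by apply: exprn_ege1; case: lam_big; lra. Qed.

Lemma depth_pow_lo : lam ^+ 4 * x ^+ 2 <= N.
Proof. by case/andP: hm => + _; rewrite /x -exprM -exprD addnC mulnC. Qed.

Lemma depth_pow_hi : N < lam ^+ 6 * x ^+ 2.
Proof. by case/andP: hm => _; rewrite /x -exprM -exprD addnC mulnC. Qed.

(** Take logarithms in the lower half of [hm]. As a result, m relative errors of size z / lam add up
    to at most 1 / (4z). *)
Lemma depth_le : 4 * m%:R * z ^+ 2 <= lam.
Proof.
have [l0 _] := lam_big.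
case/andP: hm => + _; rewrite -ler_ln ?posrE ?exprn_gt0 ?natr_gt0 ?lam_gt0 //.
rewrite lnXn ?lam_gt0 // ln_lam -[leLHS]mulr_natr natrD natrM.
have -> : ln N = lam / 2 by rewrite lamE; field.
by have := sqr_ge0 z; have : 0 <= m%:R :> R by []; move: (m%:R) (z ^+ 2) => M' w; nra.
Qed.

Lemma depth_lt : m%:R + 1 <= lam.
Proof.
have [l0 _] := lam_big; have z2 := z256; have dl := depth_le.
have : 0 <= m%:R * (z ^+ 2 - 1) :> R.
  by rewrite mulr_ge0 // subr_ge0 exprn_ege1 //; lra.
by lra.
Qed.

(** The 2 stands for the edges shared with the first path. As (lam + 2)(1 - 2/lam) is at most lam,
    Bernoulli's inequality and 2m/lam at most 1/z suffice. *)
Lemma depth_growth : (lam + 2) ^+ m * (1 - z^-1) <= x.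
Proof.
have [l0 _] := lam_big; have z0 : 0 < z by have := z256; lra.
have h : 1 - z^-1 <= (1 - 2 / lam) ^+ m.
  apply: le_trans (bernoulli_sub m _); last first.
    by rewrite divr_ge0 ?ler_pdivrMr //; lra.
  rewrite lerD2l lerN2 mulrA ler_pdivrMr ?lam_gt0 // [z^-1 * _]mulrC ler_pdivlMr //.
  have dl := depth_le; have z2 := z256.
  have : 0 <= (m%:R * z) * (4 * z - 2) by rewrite !mulr_ge0 //; lra.
  by lra.
apply: (@le_trans _ _ ((lam + 2) ^+ m * (1 - 2 / lam) ^+ m)).
  by rewrite ler_wpM2l // exprn_ge0 //; lra.
rewrite -exprMn lerXn2r ?nnegrE //.
- rewrite mulr_ge0 //; first lra.
  by rewrite subr_ge0 ler_pdivrMr; lra.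
- lra.
have -> : (lam + 2) * (1 - 2 / lam) = lam - 4 / lam by field; rewrite gt_eqF ?lam_gt0.
by rewrite gerBl divr_ge0 //; lra.
Qed.

Let l0 : 256 * 256 + 1 <= lam. Proof. by case: lam_big. Qed.
Let lz : 256 * z <= lam. Proof. by case: lam_big. Qed.

Lemma lam_depth_le : 2 ^+ 20 * (lam ^+ 2 * x) <= N.
Proof.
have l1 := l0; have x1 := depth_pow_ge1; apply: le_trans depth_pow_lo.
have -> : lam ^+ 4 * x ^+ 2 = (lam ^+ 2 * x) * (lam ^+ 2 * x) by ring.
rewrite ler_wpM2r ?mulr_ge0 ?exprn_ge0 //; try lra.
apply: (@le_trans _ _ (lam ^+ 2)); last by rewrite ler_peMr // exprn_ge0 //; lra.
have -> : 2 ^+ 20 = 1024 ^+ 2 :> R by ring.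
by apply: lerXn2r; rewrite ?nnegrE; lra.
Qed.

Variable k : nat.
Hypothesis kE : k = Num.truncn (N / (lam * x)).
Local Notation K := (k%:R : R).

Let lamx0 : 0 < lam * x.
Proof. by have l1 := l0; have x1 := depth_pow_ge1; apply: mulr_gt0; lra. Qed.

Lemma block_size_hi : K * (lam * x) <= N.
Proof.
rewrite -ler_pdivlMr // kE.
by have /andP[] := truncn_itv (divr_ge0 (ltW natr_gt0) (ltW lamx0)).
Qed.

Lemma block_size_lo : N <= 2 * K * (lam * x).
Proof.
have h : N < (K + 1) * (lam * x).
  rewrite -ltr_pdivrMr // kE natr1; exact: truncnS_gt.
have h2 : 2 * (lam * x) <= N.
  have l1 := l0; have x1 := depth_pow_ge1; have := lam_depth_le.
  have : 0 <= (lam - 2) * (lam * x) by rewrite mulr_ge0 // ?(ltW lamx0) //; lra.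
  have : 0 <= lam ^+ 2 * x by rewrite mulr_ge0 ?exprn_ge0 //; lra.
  move=> h3 h4 h5; nra.
lra.
Qed.

Lemma block_size_gt0 : (0 < k)%N.
Proof.
rewrite lt0n; apply/negP => /eqP k0; have := block_size_lo; rewrite k0 mulr0 mul0r.
by rewrite leNgt natr_gt0.
Qed.

(** The upper half of [hm] says that [lam * x] exceeds [Num.sqrt N / lam ^+ 2]. *)
Lemma block_size_le_sqrt : K <= Num.sqrt N * lam ^+ 2.
Proof.
have l1 := l0; have x1 := depth_pow_ge1; have N0 := natr_gt0.
have l3x : 0 <= lam ^+ 3 * x by rewrite mulr_ge0 ?exprn_ge0 //; lra.
have sN : Num.sqrt N <= lam ^+ 3 * x.
  rewrite -(ger0_norm l3x) -sqrtr_sqr ler_sqrt ?sqr_ge0 //.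
  have -> : (lam ^+ 3 * x) ^+ 2 = lam ^+ 6 * x ^+ 2 by ring.
  exact: ltW depth_pow_hi.
rewrite -(ler_pM2r lamx0); apply: le_trans block_size_hi _.
rewrite -[leLHS](sqr_sqrtr (ltW N0)) expr2.
have -> : Num.sqrt N * lam ^+ 2 * (lam * x) = Num.sqrt N * (lam ^+ 3 * x) by ring.
by rewrite ler_wpM2l ?sqrtr_ge0.
Qed.

Variables (mW M : nat).
Hypothesis mWE : mW = (Num.truncn (z * N / lam)).+1.
Hypothesis ME : M = Num.truncn (N ^+ 2 / (2 ^+ 15 * lam ^+ 2)).

Let z0 : 0 < z. Proof. by have := z256; lra. Qed.
Let lam0 : 0 < lam. Proof. exact: lam_gt0. Qed.
Let N0 : 0 < N. Proof. exact: natr_gt0. Qed.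

Lemma last_layer_itv : z * N / lam <= mW%:R <= z * N / lam + 1.
Proof.
have zN : 0 <= z * N / lam.
  by apply: divr_ge0; [apply: mulr_ge0; apply: ltW|apply: ltW].
have /andP[h1 h2] := truncn_itv zN.
by rewrite mWE (ltW h2) -natr1 lerD2r h1.
Qed.

Lemma last_layer_mean_itv : z <= mW%:R * p <= z + 1.
Proof.
have /andP[h1 h2] := last_layer_itv; have /andP[p0 p1] := pn_bounds.
have e : z * N / lam * p = z by rewrite pn_lam; field; rewrite !gt_eqF.
by have := ler_wpM2r p0 h1; have := ler_wpM2r p0 h2; rewrite mulrDl e mul1r; lra.
Qed.

Lemma used_vertices_le : (k + mW + m)%:R <= 3 * z * N / lam.
Proof.
have /andP[_ h2] := last_layer_itv; have := block_size_hi; have := depth_lt; have l1 := l0; have x1 := depth_pow_ge1.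
have z2 := z256; have N1 := N0; have := natr_ge_lam (isT : (2 <= 8)%N).
rewrite !natrD => hN hm' hk; have l2 := lz.
have {}hk : K * lam <= N.
  apply: le_trans hk; rewrite mulrA ler_peMr // mulr_ge0 //; lra.
rewrite ler_pdivlMr //.
have {}h2 : mW%:R * lam <= z * N + lam.
  have := ler_wpM2r (ltW lam0) h2; rewrite mulrDl divfK ?mul1r //; by rewrite gt_eqF.
have h3 : (m%:R + 1) * lam <= N.
  apply: le_trans hN; apply: (@le_trans _ _ (lam ^+ 2)).
    by rewrite expr2 ler_wpM2r // ltW.
  by rewrite ler_peMl ?sqr_ge0 // exprn_ege1 // ler1n.
have : 0 <= (z - 2) * N by rewrite mulr_ge0; lra.
by rewrite !mulrDl in h3 *; lra.
Qed.

Lemma used_vertices_small : 3 * z * N / lam <= N.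
Proof.
have l2 := lz; rewrite ler_pdivrMr // mulrC ler_wpM2l ?ltW //.
by have := z0; lra.
Qed.

Lemma used_vertices_le_n : (k + mW + m <= n)%N.
Proof. by rewrite -(ler_nat R); apply: le_trans used_vertices_le used_vertices_small. Qed.

(** The longest paths dominate, with a term [lam ^+ (2 * m + 3) / N]; the lower half of [hm] leaves
    a spare factor [lam]. *)
Lemma close_sum : \sum_(i < 2 * m + 3) N ^+ i * p ^+ i.+1 <= 2 / lam.
Proof.
have /andP[p0 p1] := pn_bounds; have l1 := l0.
rewrite addnS; apply: le_trans (geometric_le _ p0 _) _; rewrite mean_degree; first lra.
rewrite ler_pdivlMr // {1}pn_lam.
have -> : 2 * (lam / N) * lam ^+ (2 * m + 2) * lam = 2 * (lam ^+ (2 * m + 4) / N).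
  by rewrite (addnC (2 * m)%N 4%N) (addnC (2 * m)%N 2%N) !exprD; ring.
by rewrite -[leRHS]mulr1 ler_wpM2l // ler_pdivrMr // mul1r; case/andP: hm.
Qed.

(** Leaving out a fraction 3z / lam of the vertices costs a factor 1 - 1/z over the m inner
    vertices, by [depth_le]; the step into W contributes [z]. *)
Lemma fan_lower : x * (z - 1) <= (n - k - mW - m)%:R ^+ m * mW%:R * p ^+ m.+1.
Proof.
have /andP[p0 p1] := pn_bounds; have /andP[w1 w2] := last_layer_mean_itv; have x1 := depth_pow_ge1.
have l1 := l0; have l2 := lz; have z1 := z0; have dl := depth_le.
have -> : (n - k - mW - m = n - (k + mW + m))%N by rewrite -!subnDA addnA.
rewrite natrB ?used_vertices_le_n //; set t := (k + mW + m)%:R.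
have -> : (N - t) ^+ m * mW%:R * p ^+ m.+1 = ((N - t) * p) ^+ m * (mW%:R * p).
  by rewrite [in RHS]exprMn exprSr mulrACA.
have h1 : lam * (1 - 3 * z / lam) <= (N - t) * p.
  rewrite mulrBl mean_degree mulrBr mulr1 lerD2l lerN2.
  apply: le_trans (ler_wpM2r p0 used_vertices_le) _.
  by rewrite pn_lam le_eqVlt; apply/orP; left; apply/eqP; field; rewrite !gt_eqF.
have z3 : 0 <= 3 * z / lam <= 1.
  by rewrite divr_ge0 ?ler_pdivrMr //; lra.
have h2 : x * (1 - z^-1) <= ((N - t) * p) ^+ m.
  apply: (@le_trans _ _ ((lam * (1 - 3 * z / lam)) ^+ m)); last first.
    have h0 : 0 <= lam * (1 - 3 * z / lam) by rewrite mulr_ge0 ?(ltW lam0) //; lra.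
    by rewrite lerXn2r ?nnegrE // (le_trans h0 h1).
  rewrite exprMn ler_wpM2l //; first lra.
  apply: le_trans (bernoulli_sub m z3).
  rewrite lerD2l lerN2 mulrA ler_pdivrMr // [z^-1 * _]mulrC ler_pdivlMr //.
  have : 0 <= m%:R * z ^+ 2 by rewrite mulr_ge0 ?sqr_ge0.
  lra.
apply: (@le_trans _ _ (x * (1 - z^-1) * z)).
  have -> : x * (1 - z^-1) * z = x * (z - 1) by field; rewrite gt_eqF.
  by [].
have iz : 0 <= 1 - z^-1 by rewrite subr_ge0 invf_le1 //; have := z256; lra.
by apply: ler_pM => //; [rewrite mulr_ge0 //; lra|exact: ltW].
Qed.

Lemma depth_growth2 : (lam + 2) ^+ m <= 2 * x.
Proof.
have := depth_growth; have z2 := z256; have l1 := l0; have x1 := depth_pow_ge1.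
have : 0 <= (lam + 2) ^+ m by rewrite exprn_ge0 //; lra.
have iz : z^-1 <= 2^-1 by rewrite lef_pV2 ?posrE //; lra.
move: ((lam + 2) ^+ m) (z^-1) iz => w y iz w0 h.
have : 0 <= w * (2^-1 - y) by rewrite mulr_ge0 //; lra.
lra.
Qed.

(** This dictates the block size: with [K * p * x] at most 1, a path shares its end with boundedly
    many others on average. *)
Lemma collision_bound : (m.+1 + k)%:R * p * (lam + 2) ^+ m <= 5.
Proof.
have /andP[p0 p1] := pn_bounds; have l1 := l0; have x1 := depth_pow_ge1; have N1 := N0.
apply: (@le_trans _ _ ((m.+1 + k)%:R * p * (2 * x))).
  by rewrite ler_wpM2l ?depth_growth2 // mulr_ge0.
have -> : (m.+1 + k)%:R * p * (2 * x) = ((m.+1 + k)%:R * (2 * (lam * x))) / N.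
  by rewrite pn_lam; ring.
rewrite ler_pdivrMr // natrD -natr1.
have : (m%:R + 1) * (lam * x) <= lam ^+ 2 * x.
  by rewrite [lam ^+ 2]expr2 -mulrA ler_wpM2r ?(ltW lamx0) //; apply: depth_lt.
have := lam_depth_le; have := block_size_hi.
have : 0 <= lam ^+ 2 * x by rewrite mulr_ge0 ?exprn_ge0 //; lra.
by move: (lam ^+ 2 * x) (lam * x) => u v; lra.
Qed.

Lemma slot_count_hi : M%:R <= N ^+ 2 / (2 ^+ 15 * lam ^+ 2).
Proof.
have h0 : 0 <= N ^+ 2 / (2 ^+ 15 * lam ^+ 2).
  by apply: divr_ge0; [exact: sqr_ge0|apply: mulr_ge0; [exact: exprn_ge0|exact: sqr_ge0]].
by have /andP[+ _] := truncn_itv h0; rewrite -ME.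
Qed.

Lemma slot_count_lo : N / (2 ^+ 15 * lam) - 1 <= p * M%:R.
Proof.
have /andP[p0 p1] := pn_bounds.
have h : N ^+ 2 / (2 ^+ 15 * lam ^+ 2) <= M%:R + 1.
  by rewrite natr1 ME; apply: ltW; apply: truncnS_gt.
have := ler_wpM2l p0 h; rewrite mulrDr mulr1 {1}pn_lam.
have -> : lam / N * (N ^+ 2 / (2 ^+ 15 * lam ^+ 2)) = N / (2 ^+ 15 * lam).
  by field; rewrite !gt_eqF.
lra.
Qed.

(** Origin of [2 ^+ 15]: [K * (lam * x)] is at least N/2 and z - 1 at least 3z/4, so the right-hand
    root is at least 3zN / (8 lam). Its square divided by 2 (48z)^2 is N^2 / (2^15 lam^2), free of
    [z]. *)
Lemma slots_bound : (2 * M)%:R * (48 * z) ^+ 2 <= (K * (x * (z - 1))) ^+ 2.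
Proof.
have z2 := z256; have x1 := depth_pow_ge1; have z1 := z0; have N1 := N0; have l1 := lam0.
have h : 3 * z * N / (8 * lam) <= K * (x * (z - 1)).
  rewrite ler_pdivrMr ?mulr_gt0 //.
  have : 0 <= (2 * K * (lam * x) - N) * (4 * (z - 1)).
    by rewrite mulr_ge0 //; [rewrite subr_ge0; apply: block_size_lo|lra].
  have : 0 <= N * (z - 4) by rewrite mulr_ge0 //; lra.
  lra.
apply: (@le_trans _ _ ((3 * z * N / (8 * lam)) ^+ 2)); last first.
  have h0 : 0 <= 3 * z * N / (8 * lam) by rewrite divr_ge0 ?mulr_ge0 //; lra.
  by rewrite lerXn2r ?nnegrE // (le_trans h0 h).
rewrite natrM; apply: (@le_trans _ _ (2 * (N ^+ 2 / (2 ^+ 15 * lam ^+ 2)) * (48 * z) ^+ 2)).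
  by rewrite ler_wpM2r ?sqr_ge0 // ler_wpM2l // slot_count_hi.
rewrite le_eqVlt; apply/orP; left; apply/eqP; field; by rewrite gt_eqF.
Qed.

(** By [depth_growth] and [last_layer_mean_itv] the quotient is at most z(z + 3) / (z - 1)^2. *)
Lemma ratio_bound :
  (lam + 2) ^+ m * (mW%:R * p + 2) / (x * (z - 1)) - 1 <= 12 / z.
Proof.
have z2 := z256; have x1 := depth_pow_ge1; have z1 := z0; have l1 := lam0.
have /andP[w1 w2] := last_layer_mean_itv.
have x0 : 0 < x by lra.
have h0 : 0 <= (lam + 2) ^+ m by rewrite exprn_ge0 //; lra.
rewrite lerBlDr ler_pdivrMr; last by rewrite mulr_gt0 //; lra.
have h1 : (lam + 2) ^+ m <= x * z / (z - 1).
  rewrite ler_pdivlMr; last lra.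
  have := ler_wpM2r (ltW z1) depth_growth; rewrite -mulrA mulrBl mul1r mulVf //.
  by rewrite gt_eqF.
apply: (@le_trans _ _ (x * z / (z - 1) * (z + 3))).
  by apply: ler_pM => //; lra.
have -> : x * z / (z - 1) * (z + 3) = x * (z * (z + 3) / (z - 1)).
  by field; rewrite gt_eqF //; lra.
have -> : (12 / z + 1) * (x * (z - 1)) = x * ((12 + z) * (z - 1) / z).
  by field; rewrite gt_eqF.
rewrite ler_wpM2l ?(ltW x0) // ler_pdivlMr // mulrAC ler_pdivrMr; last lra.
nra.
Qed.

Lemma delta_bound :
  4 / K + 4 * (2 / lam) + 32 * ((lam + 2) ^+ m * (mW%:R * p + 2) / (x * (z - 1)) - 1)
    + z^-1 <= 400 / z.
Proof.
have z2 := z256; have x1 := depth_pow_ge1; have z1 := z0; have l1 := lam0; have l2 := lz.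
have K0 : 0 < K by rewrite ltr0n block_size_gt0.
have lz1 : lam^-1 <= 256^-1 * z^-1.
  rewrite -invfM lef_pV2; [exact: l2|exact: l1|].
  by rewrite posrE mulr_gt0 ?ltr0n.
have iz : 0 < z^-1 by rewrite invr_gt0.
have h1 : K^-1 <= lam^-1.
  rewrite lef_pV2 ?posrE //; have := block_size_lo; have := lam_depth_le.
  move=> h2 h3; have : 2 * lam * (lam * x) <= 2 * K * (lam * x).
    apply: le_trans h3; apply: le_trans h2.
    have -> : 2 * lam * (lam * x) = 2 * (lam ^+ 2 * x) by ring.
    rewrite ler_wpM2r //; first by rewrite mulr_ge0 ?exprn_ge0 ?ltW //; lra.
    by rewrite -[leLHS]expr1 ler_eXn2l // ltr1n.
  by rewrite ler_pM2r // ler_pM2l.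
have rb := ratio_bound; move: rb h1 lz1 iz.
by move: (_ / (x * _) - 1) (K^-1) (lam^-1) (z^-1) => a b c d; lra.
Qed.

Variable q : nat.
Hypothesis qE : q = (n %/ k)%N.

Lemma blocks_fit : (q * k <= n)%N.
Proof. by rewrite qE leq_trunc_div. Qed.

Lemma block_size_le_n : (k <= n)%N.
Proof. by apply: leq_trans used_vertices_le_n; rewrite -addnA leq_addr. Qed.

Lemma nblocks_gt0 : (0 < q)%N.
Proof. by rewrite qE divn_gt0 ?block_size_gt0 // block_size_le_n. Qed.

Lemma blocks_cover : N <= 2 * (q%:R * K).
Proof.
rewrite -!natrM ler_nat; apply: leq_trans (ltnW (ltn_ceil n block_size_gt0)) _.
by rewrite -qE mulnA leq_mul2r mul2n -addnn -addn1 leq_add2l nblocks_gt0 orbT.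
Qed.

Lemma blocks_typical (j : 'I_q) :
  exists typ : pred {set 'I_n * 'I_n},
   rsmean (upairs n) p (fun E => (~~ typ E)%:R) <= 400 / z /\
   forall C : rel 'I_n, rsmean (upairs n) p (fun E => (typ E &&
      [forall x in block n k j, forall y in block n k j,
         close E (2 * m + 3) x y == C x y])%:R) <= (1 - p) ^+ M.
Proof.
have cb := card_block block_size_gt0 blocks_fit j; have x1 := depth_pow_ge1; have z2 := z256.
have [|||||||||typ [t1 t2]] := @typical_part R n p pn_bounds (block n k j) mW m M
  (lam + 2) (2 / lam) (x * (z - 1)) z.
- by rewrite cb block_size_gt0.
- by rewrite cb; apply: leq_trans used_vertices_le_n; rewrite leq_addr.
- by rewrite mean_degree.
- by clear cb; rewrite mulr_gt0 //; lra.
- exact: z0.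
- exact: close_sum.
- by rewrite cb; apply: fan_lower.
- by rewrite cb; apply: collision_bound.
- by rewrite cb; apply: slots_bound.
exists typ; split=> //; apply: le_trans t1 _; rewrite cb; exact: delta_bound.
Qed.

Variable mu : nat.
Hypothesis muE : mu = Num.truncn (2 * (2 ^+ 23)^-1 * bound_fn R n / q%:R).

(** Origin of [2 ^+ 23]: [bound_fn] is 16 N sqrt(N) / lam^4, 1/q is at most 2K/N, and K at most
    sqrt(N) lam^2, which leaves [2 ^+ 17]. This is four times [2 ^+ 15], so that the codes stay
    below the gain from the excluded edges. *)
Lemma budget_hi : mu%:R <= N / (2 ^+ 17 * lam ^+ 2).
Proof.
have q0 : 0 < q%:R :> R by rewrite ltr0n nblocks_gt0.
have K0 : 0 < K by rewrite ltr0n block_size_gt0.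
have s0 := sqrtr_ge0 N; have lN : ln N = lam / 2 by rewrite lamE; field.
have bE : bound_fn R n = 16 * N * Num.sqrt N / lam ^+ 4.
  by rewrite /bound_fn lN; field; rewrite gt_eqF.
have b0 : 0 <= bound_fn R n.
  rewrite bE; apply: divr_ge0; last by apply: exprn_ge0; apply: ltW.
  by rewrite !mulr_ge0 // ltW.
have iq : q%:R^-1 <= 2 * K / N.
  by rewrite ler_pdivlMr // mulrC ler_pdivrMr // -mulrA [K * _]mulrC blocks_cover.
have c0 : 0 <= 2 * (2 ^+ 23)^-1 * bound_fn R n.
  by apply: mulr_ge0 => //; apply: mulr_ge0 => //; apply: ltW.
have h0 : 0 <= 2 * (2 ^+ 23)^-1 * bound_fn R n / q%:R by rewrite divr_ge0.
have /andP[+ _] := truncn_itv h0; rewrite -muE => /le_trans; apply.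
apply: le_trans (ler_wpM2l c0 iq) _.
apply: (@le_trans _ _ ((2 ^+ 17)^-1 * Num.sqrt N / lam ^+ 4 * K)).
  by rewrite bE le_eqVlt; apply/orP; left; apply/eqP; field; rewrite !gt_eqF.
have -> : N / (2 ^+ 17 * lam ^+ 2) =
    (2 ^+ 17)^-1 * Num.sqrt N / lam ^+ 4 * (Num.sqrt N * lam ^+ 2).
  rewrite -{1}(sqr_sqrtr (ltW N0)); field; by rewrite gt_eqF.
apply: ler_wpM2l block_size_le_sqrt.
by apply: divr_ge0; [rewrite mulr_ge0 // invr_ge0 exprn_ge0|apply: exprn_ge0; apply: ltW].
Qed.

Lemma budget_cost (t : nat) : t%:R < (2 ^+ 23)^-1 * bound_fn R n -> (2 * t < q * mu.+1)%N.
Proof.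
move=> ht; have q0 : 0 < q%:R :> R by rewrite ltr0n nblocks_gt0.
rewrite -(ltr_nat R) !natrM.
have := truncnS_gt (2 * (2 ^+ 23)^-1 * bound_fn R n / q%:R); rewrite -muE.
rewrite ltr_pdivrMr // [_ * q%:R]mulrC; apply: lt_trans.
by rewrite -mulrA ltr_pM2l.
Qed.

(** With w = N / (2^17 lam), the codes cost exp(3w) and the excluded edges gain exp(4w - 1); the
    remaining w pays for the at most n blocks. *)
Lemma codes_bound (A : R) : 0 <= A -> A <= expR (3 * (N / (2 ^+ 17 * lam))) ->
  q%:R * (A * (1 - p) ^+ M) <= z^-1.
Proof.
move=> A0 hA; have /andP[p0 p1] := pn_bounds; have l1 := l0; have l2 := lz; have z1 := z0.
have qN : q%:R <= expR (lam / 2).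
  by rewrite -natr_expR ler_nat; apply: leq_trans blocks_fit; rewrite leq_pmulr ?block_size_gt0.
have hp : (1 - p) ^+ M <= expR (- (p * M%:R)).
  have -> : - (p * M%:R) = M%:R * (- p) by ring.
  rewrite expRM_natl lerXn2r ?nnegrE ?expR_ge0 ?subr_ge0 //.
  exact: expR_ge1Dx.
have p0' : 0 <= (1 - p) ^+ M by rewrite exprn_ge0 // subr_ge0.
apply: (@le_trans _ _ (expR (lam / 2) *
   (expR (3 * (N / (2 ^+ 17 * lam))) * expR (- (p * M%:R))))).
  by rewrite ler_pM ?mulr_ge0 // ler_pM.
rewrite -!expRD; apply: (@le_trans _ _ (expR (- lam))).
  rewrite ler_expR; have := slot_count_lo.
  have e1 : N / (2 ^+ 15 * lam) = 4 * (N / (2 ^+ 17 * lam)) by field; rewrite gt_eqF.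
  have h2 : 2 * lam + 1 <= N / (2 ^+ 17 * lam).
    rewrite ler_pdivlMr ?mulr_gt0 // ?exprn_gt0 //.
    have := natr_ge_lam (isT : (2 <= 8)%N); rewrite expr2; apply: le_trans.
    have h : (2 * lam + 1) * lam <= 3 * (lam * lam).
      by rewrite mulrA ler_pM2r //; lra.
    have h3 : 2 ^+ 17 * 3 <= 2 ^+ 48 :> R by rewrite -!natrX -natrM ler_nat; clear; lia.
    rewrite mulrCA; apply: (@le_trans _ _ (2 ^+ 17 * (3 * (lam * lam)))).
      by apply: ler_wpM2l h; apply: exprn_ge0.
    by rewrite [leLHS]mulrA; apply: ler_wpM2r h3; rewrite mulr_ge0 // ltW.
  rewrite e1; move: (N / (2 ^+ 17 * lam)) h2 => w h2; lra.
rewrite expRN lef_pV2 ?posrE ?expR_gt0 //.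
by have := expR_ge1Dx lam; lra.
Qed.

Lemma event_le (P : {set 'I_n * 'I_n} -> Prop) (T : finType) (C : 'I_q -> T -> rel 'I_n) :
  #|T|%:R <= expR (3 * (N / (2 ^+ 17 * lam))) ->
  (forall E : {set 'I_n * 'I_n}, E \subset upairs n -> P E ->
     exists2 cost : 'I_n -> nat, (\sum_v cost v)%:R < (2 ^+ 23)^-1 * bound_fn R n &
       forall j, (\sum_(v in block n k j) cost v <= mu)%N ->
        exists c, {in block n k j &, forall x y, close E (2 * m + 3) x y = C j c x y}) ->
  ER_prob p P <= 801 / z.
Proof.
move=> hT hP.
have h := @mean_union R n p pn_bounds k q block_size_gt0 nblocks_gt0 blocks_fit P T C mu _ M _ blocks_typical.
apply: le_trans (h _) _.
  by move=> E EU /(hP E EU)[cost hc hj]; exists cost => //; apply: budget_cost.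
(* Twice 400 / z for the atypical blocks and 1 / z for the codes. *)
have := codes_bound (ler0n _ _) hT; move: (q%:R * _) (z^-1) => a b; lra.
Qed.

(** The [k] separators are affordable because [k] is of order sqrt(N) lam^2 at most. For labels the
    budget [mu] has a factor [lam] to spare. *)
Lemma labels_card : (3 ^ (mu + k))%:R <= expR (3 * (N / (2 ^+ 17 * lam))).
Proof.
have l1 := l0; have N1 := N0.
have h3 : 3 <= expR (2 : R) by apply: le_trans (expR_ge1Dx _); lra.
rewrite natrX; apply: (@le_trans _ _ (expR 2 ^+ (mu + k))).
  by rewrite lerXn2r ?nnegrE ?expR_ge0.
rewrite -expRM_natl ler_expR natrD.
have h1 : mu%:R <= N / (2 ^+ 17 * lam).
  apply: le_trans budget_hi _; rewrite ler_wpM2l ?(ltW N0) // lef_pV2 ?posrE; last first.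
  - by rewrite mulr_gt0 ?exprn_gt0.
  - by rewrite mulr_gt0 ?exprn_gt0.
  rewrite ler_wpM2l ?exprn_ge0 // expr2 ler_peMr ?(ltW lam0) //; lra.
have h2 : 2 * K <= N / (2 ^+ 17 * lam).
  rewrite ler_pdivlMr ?mulr_gt0 ?exprn_gt0 //.
  have s18 : 2 ^+ 18 * lam ^+ 3 <= Num.sqrt N.
    have h0 : 0 <= 2 ^+ 18 * lam ^+ 3 by rewrite mulr_ge0 ?exprn_ge0 ?(ltW lam0).
    rewrite -(ger0_norm h0) -sqrtr_sqr ler_sqrt ?(ltW N0) //.
    apply: le_trans (natr_ge_lam (isT : (6 <= 8)%N)).
    rewrite exprMn -!exprM ler_wpM2r ?exprn_ge0 ?(ltW lam0) //.
    by apply: ler_weXn2l => //; rewrite ler1n.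
  have := ler_wpM2r (sqrtr_ge0 N) s18; rewrite -expr2 sqr_sqrtr ?(ltW N0) //.
  apply: le_trans.
  have -> : 2 * K * (2 ^+ 17 * lam) = K * (2 ^+ 18 * lam) by ring.
  have -> : 2 ^+ 18 * lam ^+ 3 * Num.sqrt N = Num.sqrt N * lam ^+ 2 * (2 ^+ 18 * lam) by ring.
  by rewrite ler_wpM2r ?block_size_le_sqrt // mulr_ge0 ?exprn_ge0 ?(ltW lam0).
lra.
Qed.

(** A stored landmark takes at most N^4 = exp(2 lam) values, which uses up the spare factor [lam] of
    the budget. *)
Lemma landmarks_card : ((n * n * n).+1 ^ mu)%:R <= expR (3 * (N / (2 ^+ 17 * lam))).
Proof.
have l1 := l0; have N1 := N0.
have n2 : (1 < n)%N.
  rewrite -(ltr_nat R); have := natr_ge_lam (isT : (0 <= 8)%N); rewrite expr0 mulr1.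
  apply: lt_le_trans; by rewrite exprn_egt1 // ltr1n.
have e4 : expR (2 * lam) = N ^+ 4.
  by rewrite natr_expR -expRM_natl; congr expR; field.
have h1 : (n * n * n).+1%:R <= expR (2 * lam).
  by rewrite e4 -natrX ler_nat !expnS expn0 muln1; move: n2; clear; nia.
rewrite natrX; apply: (@le_trans _ _ (expR (2 * lam) ^+ mu)).
  by rewrite lerXn2r ?nnegrE ?expR_ge0.
rewrite -expRM_natl ler_expR.
apply: (@le_trans _ _ (N / (2 ^+ 17 * lam ^+ 2) * (2 * lam))).
  by rewrite ler_wpM2r ?budget_hi // mulr_ge0 ?(ltW lam0).
have -> : N / (2 ^+ 17 * lam ^+ 2) * (2 * lam) = 2 * (N / (2 ^+ 17 * lam)).
  by field; rewrite gt_eqF.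
have : 0 <= N / (2 ^+ 17 * lam) by rewrite divr_ge0 ?(ltW N0) ?mulr_ge0 ?exprn_ge0 ?(ltW lam0).
lra.
Qed.

Lemma radius_lt_n : (2 * m + 3 < n)%N.
Proof.
rewrite -(ltr_nat R) natrD natrM.
have := depth_lt; have := natr_ge_lam (isT : (1 <= 8)%N); rewrite expr1; have l1 := l0.
have : 8 * lam <= 2 ^+ 48 * lam.
  by rewrite ler_pM2r // (_ : 8 = 2 ^+ 3 :> R) ?ler_weXn2l ?ler1n //; ring.
lra.
Qed.

End Depth.
End Asymptotics.

(** * Encoding the labels of a block *)

Section LabelCodes.

(** Labels need not be prefix-free, so a third symbol, [None], ends each of them. *)
Definition sep_code (ls : seq (seq bool)) : seq (option bool) :=
  flatten [seq rcons (map Some l) None | l <- ls].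

Fixpoint sep_decode (s : seq (option bool)) : seq (seq bool) :=
  match s with
  | [::] => [::]
  | None :: s' => [::] :: sep_decode s'
  | Some b :: s' => if sep_decode s' is l :: ls then (b :: l) :: ls else [:: [:: b]]
  end.

Lemma sep_codeK ls t : sep_decode (sep_code ls ++ t) = ls ++ sep_decode t.
Proof.
elim: ls => //= l ls IHls; rewrite -catA.
by elim: l => [|b l IHl] /=; rewrite ?IHls // IHl.
Qed.

Lemma size_sep_code ls : size (sep_code ls) = (\sum_(l <- ls) (size l).+1)%N.
Proof.
elim: ls => [|l ls IHls]; first by rewrite big_nil.
by rewrite big_cons -IHls /sep_code /= size_cat size_rcons size_map.
Qed.

Variables (n k q mu d : nat) (dec : decoder).
Hypotheses (k0 : (0 < k)%N) (qkn : (q * k <= n)%N) (dn : (d < n)%N).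

Definition decoded_label (j : 'I_q) (c : seq (option bool)) (v : 'I_n) :=
  nth [::] (sep_decode c) (index v (enum (block n k j))).

(** The decoder being fixed, the graph enters only through [c], so a block has at most 3^(mu + k)
    patterns. *)
Definition label_close (j : 'I_q) (c : (mu + k).-tuple (option bool)) : rel 'I_n :=
  fun x y => if dec n (decoded_label j c x) (decoded_label j c y) is Some e
             then (e <= d)%N else false.

Lemma label_closeP (E : {set 'I_n * 'I_n}) (lab : 'I_n -> seq bool) (j : 'I_q) :
  is_dist_labeling dec E lab -> (\sum_(v in block n k j) size (lab v) <= mu)%N ->
  exists c, {in block n k j &, forall x y, close E d x y = label_close j c x y}.
Proof.
move=> labE hmu; pose ls := [seq lab v | v <- enum (block n k j)].
have sz : (size (sep_code ls) <= mu + k)%N.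
  rewrite size_sep_code big_map big_enum /= (eq_bigr (fun v => size (lab v) + 1)%N); last first.
    by move=> v _; rewrite addn1.
  by rewrite big_split /= sum1_card card_block // leq_add2r.
(* Padding with [None] only appends empty labels, beyond the index of any vertex of the block. *)
pose c := sep_code ls ++ nseq (mu + k - size (sep_code ls)) None.
have szc : size c == (mu + k)%N by rewrite size_cat size_nseq subnKC.
have lbl v : v \in block n k j -> decoded_label j c v = lab v.
  move=> vj; rewrite /decoded_label sep_codeK nth_cat size_map index_mem mem_enum vj.
  by rewrite (nth_map v) ?index_mem ?mem_enum // nth_index // mem_enum.
exists (Tuple szc) => x y xj yj.
by rewrite /label_close /= !lbl // labE close_dist.
Qed.

End LabelCodes.

(** * Encoding the landmarks of a block *)

Section LandmarkCodes.
Variables (n k q mu d : nat).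
Hypotheses (k0 : (0 < k)%N) (qkn : (q * k <= n)%N) (dn : (d < n)%N).

Lemma dist_sym (E : {set 'I_n * 'I_n}) x y : dist E x y = dist E y x.
Proof.
rewrite /dist (@eq_find _ (walkb E x y) (walkb E y x)) // => i.
by apply/idP/idP => /walkb_sym.
Qed.

Lemma dist_lt (E : {set 'I_n * 'I_n}) x y e : dist E x y = Some e -> (e < n)%N.
Proof. by rewrite /dist; case: ifP => // h [<-]. Qed.

Definition landmark_close (c : mu.-tuple (option ('I_n * 'I_n * 'I_n))) : rel 'I_n :=
  fun x y => [exists t : 'I_n * 'I_n * 'I_n,
    [&& Some (x, t.1.1, t.1.2) \in c, Some (y, t.1.1, t.2) \in c & (t.1.2 + t.2 <= d)%N]].

Lemma landmark_closeP (E : {set 'I_n * 'I_n}) (L : 'I_n -> {set 'I_n}) (j : 'I_q) :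
  is_2hop_cover E L -> (\sum_(v in block n k j) #|L v| <= mu)%N ->
  exists c, {in block n k j &, forall x y, close E d x y = landmark_close c x y}.
Proof.
move=> LE hmu.
(* [None] marks a landmark in another component and later the padding; a finite distance is below
   [n], so it fits in an ordinal. *)
pose f v w : option ('I_n * 'I_n * 'I_n) :=
  if dist E v w is Some e then omap (fun e' => (v, w, e')) (insub e) else None.
pose s := [seq f v w | v <- enum (block n k j), w <- enum (L v)].
have sz : (size s <= mu)%N.
  rewrite size_allpairs_dep sumnE big_map big_enum /=.
  by under eq_bigr do rewrite -cardE.
pose c := s ++ nseq (mu - size s) None.
have szc : size c == mu by rewrite size_cat size_nseq subnKC.
have cP v w (e : 'I_n) : reflect [/\ v \in block n k j, w \in L v & dist E v w = Some (e : nat)]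
    (Some (v, w, e) \in c).
  rewrite mem_cat mem_nseq andbF orbF; apply: (iffP allpairsPdep).
    case=> v' [w' []]; rewrite !mem_enum /f => vj wL.
    case dE: (dist E v' w') => [e'|] //; case: insubP => //= e2 _ e2E [-> -> ->].
    by rewrite e2E.
  case=> vj wL dE; exists v, w; rewrite !mem_enum vj wL /f dE valK; split => //.
exists (Tuple szc) => x y xj yj; rewrite close_dist //; apply/idP/existsP.
  case dE: (dist E x y) => [e|] // ed; have [[w]] := LE _ _ _ dE.
  rewrite inE => /andP[wx wy]; case d1: (dist E x w) => [e1|] //.
  case d2: (dist E w y) => [e2|] // [eE] _.
  exists (w, Ordinal (dist_lt d1), Ordinal (dist_lt d2)) => /=; rewrite eE ed andbT.
  by apply/andP; split; apply/cP; split => //; rewrite dist_sym.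
(* Conversely, the two stored distances are lengths of walks, whose concatenation through [w] joins
   [x] to [y]. *)
case=> -[[w e1] e2] /= /and3P[/cP[_ _ d1] /cP[_ _ d2] e12].
rewrite -close_dist //; apply/closeP; exists (e1 + e2)%N => //.
by apply: walkb_cat (dist_walkb d1) _; apply/walkb_sym/dist_walkb.
Qed.

End LandmarkCodes.

(** * Passage to the limit *)

Section Limit.
Variable R : realType.

(** The scale [z] as a function of [n]. It grows like sqrt(log log n), which is the rate obtained
    for the error. *)
Definition slow (n : nat) : R := Num.sqrt (ln (2 * ln n%:R)).

Lemma slow_sqr n : 256 <= slow n -> ln (2 * ln n%:R) = slow n ^+ 2 :> R.
Proof.
move=> z256; rewrite /slow sqr_sqrtr // leNgt; apply/negP => h.
by move: z256; rewrite /slow ler0_sqrtr ?(ltW h) // lern0.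
Qed.

Lemma labeling_prob (n : nat) (dec : decoder) : 256 <= slow n ->
  ER_prob (pn R n) (fun E => exists lab : 'I_n -> seq bool,
    is_dist_labeling dec E lab /\
    (total_length lab)%:R < (2 ^+ 23)^-1 * bound_fn R n) <= 801 / slow n.
Proof.
move=> z256; have lz := slow_sqr z256.
have [m hm] := exists_depth erefl lz z256.
pose k := Num.truncn (n%:R / (2 * ln n%:R * (2 * ln n%:R) ^+ m) : R).
pose q := (n %/ k)%N.
pose mu := Num.truncn (2 * (2 ^+ 23)^-1 * bound_fn R n / q%:R).
have k0 : (0 < k)%N by apply: (block_size_gt0 erefl lz z256 hm erefl).
have dn : (2 * m + 3 < n)%N := radius_lt_n erefl lz z256 hm.
have qkn : (q * k <= n)%N by apply: leq_trunc_div.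
apply: (@event_le R n (2 * ln n%:R) (slow n) erefl lz z256 m hm k erefl
  _ _ erefl erefl q erefl mu erefl _ _ (@label_close n k q mu (2 * m + 3) dec)).
  rewrite card_tuple card_option card_bool.
  exact: (labels_card erefl lz z256 hm erefl erefl erefl erefl).
move=> E EU [lab [labE labT]]; exists (fun v => size (lab v)) => // j hj.
exact: label_closeP labE hj.
Qed.

Lemma cover_prob (n : nat) : 256 <= slow n ->
  ER_prob (pn R n) (fun E => exists L : 'I_n -> {set 'I_n},
    is_2hop_cover E L /\
    (num_landmarks L)%:R < (2 ^+ 23)^-1 * bound_fn R n) <= 801 / slow n.
Proof.
move=> z256; have lz := slow_sqr z256.
have [m hm] := exists_depth erefl lz z256.
pose k := Num.truncn (n%:R / (2 * ln n%:R * (2 * ln n%:R) ^+ m) : R).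
pose q := (n %/ k)%N.
pose mu := Num.truncn (2 * (2 ^+ 23)^-1 * bound_fn R n / q%:R).
have k0 : (0 < k)%N by apply: (block_size_gt0 erefl lz z256 hm erefl).
have dn : (2 * m + 3 < n)%N := radius_lt_n erefl lz z256 hm.
have qkn : (q * k <= n)%N by apply: leq_trunc_div.
apply: (@event_le R n (2 * ln n%:R) (slow n) erefl lz z256 m hm k erefl
  _ _ erefl erefl q erefl mu erefl _ _ (fun _ => @landmark_close n mu (2 * m + 3))).
  rewrite card_tuple card_option !card_prod card_ord.
  exact: (landmarks_card erefl lz z256 hm erefl erefl erefl erefl).
move=> E EU [L [LE LT]]; exists (fun v => #|L v|) => // j hj.
exact: landmark_closeP LE hj.
Qed.

Local Open Scope classical_set_scope.

Lemma slow_dvg (A : R) : \forall n \near \oo, A <= slow n.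
Proof.
exists (Num.truncn (expR (expR (A ^+ 2) / 2))).+1 => //= n hn.
have hN : expR (expR (A ^+ 2) / 2) <= n%:R.
  by apply: ltW; apply: lt_le_trans (truncnS_gt _) _; rewrite ler_nat.
have N0 : 0 < n%:R :> R by apply: lt_le_trans hN; apply: expR_gt0.
have h1 : expR (A ^+ 2) / 2 <= ln n%:R.
  by rewrite -[leLHS]expRK ler_ln ?posrE ?expR_gt0.
have h2 : expR (A ^+ 2) <= 2 * ln n%:R by move: h1; lra.
have h3 : A ^+ 2 <= ln (2 * ln n%:R).
  rewrite -[leLHS]expRK ler_ln ?posrE ?expR_gt0 //.
  by apply: lt_le_trans h2; apply: expR_gt0.
apply: le_trans (ler_norm A) _; rewrite -sqrtr_sqr ler_sqrt //.
exact: le_trans (sqr_ge0 A) h3.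
Qed.

Lemma ER_prob_cvg0 (P : forall n, {set 'I_n * 'I_n} -> Prop) :
  (forall n, 256 <= slow n -> ER_prob (pn R n) (P n) <= 801 / slow n) ->
  ER_prob (pn R n) (P n) @[n --> \oo] --> (0 : R).
Proof.
move=> hP; apply/cvgrPdist_le => e e0; near=> n.
have z256 : 256 <= slow n by near: n; apply: slow_dvg.
have ze : 801 / e <= slow n by near: n; apply: slow_dvg.
have z0 : 0 < slow n by apply: lt_le_trans z256; rewrite ltr0n.
rewrite sub0r normrN ger0_norm; last first.
  apply: (rsmean_ge0 (pn_bounds erefl (slow_sqr z256) z256)) => E _; exact: ler0n.
apply: le_trans (hP n z256) _.
by rewrite ler_pdivrMr // mulrC -ler_pdivrMr.
Unshelve. all: by end_near.
Qed.

End Limit.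

Local Open Scope classical_set_scope.

Theorem theorem6p1 (R : realType) :
  exists2 c : R, 0 < c &
    (forall dec : decoder,
      ER_prob (pn R n) (fun E =>
          exists lab : 'I_n -> seq bool,
            is_dist_labeling dec E lab /\
            (total_length lab)%:R < c * bound_fn R n)
        @[n --> \oo] --> (0 : R)) /\
    (ER_prob (pn R n) (fun E =>
          exists L : 'I_n -> {set 'I_n},
            is_2hop_cover E L /\
            (num_landmarks L)%:R < c * bound_fn R n)
        @[n --> \oo] --> (0 : R)).
Proof.
exists (2 ^+ 23)^-1; first by rewrite invr_gt0 exprn_gt0.
split=> [dec|]; apply: ER_prob_cvg0 => n z256.
  exact: labeling_prob.
exact: cover_prob.
Qed.
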